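(* The Secluded Path problem can be solved in polynomial time on unweighted undirected graphs of bounded (constant) maximum degree.
   Context: For $u\in V(G)$, $N[u]$ is $u$ together with its neighbors; for a subgraph $G'$, $N[G']=\bigcup_{u\in V(G')}N[u]$ and $\mathrm{Cost}(G')=|N[G']|$. Secluded Path problem: given $G$ and nodes $s,t$, find an $s$-$t$ path $P$ minimizing $\mathrm{Cost}(P)$. *)

(* Defs.v *)
From mathcomp Require Import all_boot.
Set Implicit Arguments. Unset Strict Implicit. Unset Printing Implicit Defensive.

(* Graphs: an unweighted undirected simple graph on vertices {0,...,n-1}  *)
(* given by an edge list E (pairs are unordered edges).                   *)

Definition edge_list := seq (nat * nat).

Definition wf_graph (n : nat) (E : edge_list) : bool :=
  all (fun e => [&& e.1 < n, e.2 < n & e.1 != e.2]) E.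

Definition adj (E : edge_list) : rel nat :=
  fun u v => (u != v) && (((u, v) \in E) || ((v, u) \in E)).

Definition degree (n : nat) (E : edge_list) (v : nat) : nat :=
  count (adj E v) (iota 0 n).

Definition max_degree_le (n : nat) (E : edge_list) (D : nat) : Prop :=
  forall v, v < n -> degree n E v <= D.

Definition is_st_path (E : edge_list) (s t : nat) (P : seq nat) : bool :=
  match P with
  | [::] => false
  | x :: q => [&& x == s, path (adj E) x q, last x q == t & uniq P]
  end.

Definition in_closed_nbhd (E : edge_list) (P : seq nat) (w : nat) : bool :=
  has (fun u => (u == w) || adj E u w) P.

Definition cost (n : nat) (E : edge_list) (P : seq nat) : nat :=
  count (in_closed_nbhd E P) (iota 0 n).

(* Machine model: a unit-cost RAM with addition and truncated subtraction *)
(* (polynomially equivalent to Turing machines), indirect addressing.     *)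

Inductive instr : Type :=
  | IConst of nat & nat
  | IAdd   of nat & nat & nat
  | ISub   of nat & nat & nat
  | ILoad  of nat & nat
  | IStore of nat & nat
  | IJz    of nat & nat
  | IJmp   of nat
  | IHalt.

Definition program := seq instr.
Definition memory := nat -> nat.

Record config := Config { pc : nat; mem : memory }.

Definition upd (m : memory) (a v : nat) : memory :=
  fun i => if i == a then v else m i.

Definition step (p : program) (c : config) : option config :=
  let m := mem c in
  let i := pc c in
  match nth IHalt p i with
  | IConst d k => Some (Config i.+1 (upd m d k))
  | IAdd d a b => Some (Config i.+1 (upd m d (m a + m b)))
  | ISub d a b => Some (Config i.+1 (upd m d (m a - m b)))
  | ILoad d a => Some (Config i.+1 (upd m d (m (m a))))
  | IStore a b => Some (Config i.+1 (upd m (m a) (m b)))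
  | IJz a l => Some (Config (if m a == 0 then l else i.+1) m)
  | IJmp l => Some (Config l m)
  | IHalt => None
  end.

Fixpoint run (p : program) (fuel : nat) (c : config) : config :=
  match fuel with
  | 0 => c
  | f.+1 => match step p c with None => c | Some c' => run p f c' end
  end.

Definition halted (p : program) (c : config) : bool :=
  if step p c is None then true else false.

(* Input encoding: r[0] = n, r[1] = s, r[2] = t, r[3] = |E|,
   r[4+2i], r[5+2i] = endpoints of the i-th edge, all other registers 0. *)
Definition init_mem (n s t : nat) (E : edge_list) : memory :=
  fun r =>
    if r == 0 then n else if r == 1 then s else if r == 2 then t
    else if r == 3 then size E
    else if r < 4 + 2 * size E then
      (if odd (r - 4) then (nth (0, 0) E ((r - 4)./2)).2
       else (nth (0, 0) E ((r - 4)./2)).1)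
    else 0.

Definition init_config (n s t : nat) (E : edge_list) : config :=
  Config 0 (init_mem n s t E).

(* Output decoding: r[0] = k; k = 0 means "no s-t path",
   otherwise the path is r[1], ..., r[k]. *)
Definition output (m : memory) : seq nat := [seq m i.+1 | i <- iota 0 (m 0)].

Definition secluded_path_answer (n : nat) (E : edge_list) (s t : nat)
    (out : seq nat) : Prop :=
  ((out = [::]) <-> ~ (exists P, is_st_path E s t P)) /\
  (out <> [::] ->
     is_st_path E s t out /\
     forall Q, is_st_path E s t Q -> cost n E out <= cost n E Q).

Definition solves_secluded_path_poly (D : nat) (p : program) : Prop :=
  exists c k : nat,
    forall (n s t : nat) (E : edge_list),
      wf_graph n E -> s < n -> t < n -> max_degree_le n E D ->
      let fin := run p (c * (n + size E + 1) ^ k) (init_config n s t E) in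
      halted p fin /\ secluded_path_answer n E s t (output (mem fin)).

(* Main.v *)
(** A walk from [s] to [t] that minimizes first the cost and then the length is
    an induced path, and two of its vertices with a common closed neighbour lie
    within distance [D + 4] along it: otherwise a detour through that neighbour,
    which adds at most [D + 1] vertices to the neighbourhood, would be cheaper.
    So charging each new vertex [x] with [N[x]] minus the neighbourhoods of only
    the last [W = D + 4] vertices gives the exact cost of such a walk, and an
    upper bound on the cost of every walk. Minimizing this local charge is a
    shortest-path problem over windows of [W] vertices, polynomially many for
    fixed [D]; with ties broken by the number of steps, its optimum is a simple
    path.

    The dynamic program is one course-of-values table [T p = e(p, T|_{<p})] with
    [p < N ^ (W + 2)], [N = n + |E| + 1], whose entry [e] is built by closure
    properties from folds over [N ^ k] indices. Since every loop runs exactly [N]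
    times, loops nested to a fixed depth compile to polynomial-time RAM code. *)
Require Import Defs.
From mathcomp Require Import all_boot zify.
From Stdlib Require Import Classical.
Set Implicit Arguments. Unset Strict Implicit. Unset Printing Implicit Defensive.

(** * Loop programs and their translation to the RAM *)

(** Minimality is taken over walks rather than simple paths because the common neighbour used by a
    detour may already lie on the path. Simplicity comes back for free: cutting out a repetition
    only removes vertices and shortens the walk. Cost and length are merged into the single number
    [N * cost + size]; a simple walk has at most [n < N] vertices, so length never outweighs one
    unit of cost.

    The constant [D + 4] has this origin: between two vertices of an induced path, a segment of [m]
    inner vertices contains at least [m - 2] vertices outside the neighbourhood of the rest of the
    path, and the detour that avoids the segment brings in at most [D + 1] vertices. If the detour
    is not cheaper, then [m <= D + 3].

    The machine has neither multiplication nor division, and its time bound must hold uniformly in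
    the input. Arithmetic is therefore done by counting in loops, and the time bound is read off the
    program text, so that nothing about graphs enters the time analysis. *)

Lemma run_stuck p f c : step p c = None -> run p f c = c.
Proof. by case: f => //= f ->. Qed.

Lemma run_add p a b c : run p (a + b) c = run p b (run p a c).
Proof.
elim: a c => //= a IH c.
by case E: (step p c) => [c'|] //; rewrite run_stuck.
Qed.

Definition code_at (p : program) (i : nat) (cs : seq instr) :=
  forall j, j < size cs -> nth IHalt p (i + j) = nth IHalt cs j.

Lemma code_at_cat p i c1 c2 :
  code_at p i (c1 ++ c2) -> code_at p i c1 /\ code_at p (i + size c1) c2.
Proof.
move=> H; split=> j lj.
  by rewrite H ?size_cat 1?nth_cat ?lj //; lia.
rewrite -addnA H ?size_cat ?ltn_add2l // nth_cat.
by rewrite ltnNge leq_addr /= addKn.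
Qed.

Lemma code_at_mid p1 cs p2 : code_at (p1 ++ cs ++ p2) (size p1) cs.
Proof.
move=> j lj; rewrite nth_cat ltnNge leq_addr /= addKn.
by rewrite nth_cat lj.
Qed.

Definition straight (i : instr) : bool :=
  match i with IJz _ _ | IJmp _ | IHalt => false | _ => true end.

Definition exec_instr (m : memory) (i : instr) : memory :=
  match i with
  | IConst d k => upd m d k
  | IAdd d a b => upd m d (m a + m b)
  | ISub d a b => upd m d (m a - m b)
  | ILoad d a => upd m d (m (m a))
  | IStore a b => upd m (m a) (m b)
  | _ => m
  end.

Definition exec_instrs (m : memory) (cs : seq instr) : memory :=
  foldl exec_instr m cs.

Lemma exec_instrs_cat m c1 c2 :
  exec_instrs m (c1 ++ c2) = exec_instrs (exec_instrs m c1) c2.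
Proof. by rewrite /exec_instrs foldl_cat. Qed.

Lemma run_straight p i cs m : all straight cs -> code_at p i cs ->
  run p (size cs) (Config i m) = Config (i + size cs) (exec_instrs m cs).
Proof.
elim: cs i m => [|c cs IH] i m /=; first by rewrite addn0.
case/andP=> sc scs H.
have H0: nth IHalt p i = c by rewrite -[i]addn0 H.
have H1: code_at p i.+1 cs by move=> j lj; rewrite addSnnS H.
have E: step p (Config i m) = Some (Config i.+1 (exec_instr m c)).
  by rewrite /step /= H0; clear H H0; case: c sc.
by rewrite E addnS -addSn IH.
Qed.

(** The three parts have different roles: [slot] holds the variables of a program, [tab] the table
    of the dynamic program, and [low] the registers from r[4] on, where the edge list is read and
    the answer is later written. *)
Record state := State { slot : nat -> nat; tab : nat -> nat; low : nat -> nat }.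

Definition set_slot st d v := State (upd (slot st) d v) (tab st) (low st).
Definition set_tab st d v := State (slot st) (upd (tab st) d v) (low st).
Definition set_low st d v := State (slot st) (tab st) (upd (low st) d v).

Inductive cmd :=
  | CConst of nat & nat
  | CAdd of nat & nat & nat
  | CSub of nat & nat & nat
  | CTab of nat & nat
  | CTabSet of nat & nat
  | CLow of nat & nat
  | CLowSet of nat & nat
  | CSeq of cmd & cmd
  | CIf of nat & cmd & cmd
  | CRep of cmd.

Fixpoint exec (N : nat) (c : cmd) (st : state) : state :=
  match c with
  | CConst d k => set_slot st d k
  | CAdd d a b => set_slot st d (slot st a + slot st b)
  | CSub d a b => set_slot st d (slot st a - slot st b)
  | CTab d a => set_slot st d (tab st (slot st a))
  | CTabSet a b => set_tab st (slot st a) (slot st b)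
  | CLow d a => set_slot st d (low st (minn (slot st a) (2 * N)))
  | CLowSet a b => set_low st (minn (slot st a) (2 * N)) (slot st b)
  | CSeq c1 c2 => exec N c2 (exec N c1 st)
  | CIf a c1 c2 => if slot st a == 0 then exec N c2 st else exec N c1 st
  | CRep c1 => iter N (exec N c1) st
  end.

(* [B] is the frame base, kept in r[3], with r[0], r[1], r[2] as scratch. Slots,
   table cells and loop counters are interleaved at [B + 4 x], [B + 4 q + 1] and
   [B + 4 l + 2]; counter 0 holds [N]. Low indices are clamped to [2 N] to keep
   these accesses below the frame. *)
Definition represents (N B : nat) (st : state) (m : memory) : Prop :=
  [/\ m 3 = B /\ 2 * N + 5 <= B,
      m (B + 2) = N,
      forall x, m (B + 4 * x) = slot st x,
      forall q, m (B + 4 * q + 1) = tab st q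
    & forall j, j <= 2 * N -> m (4 + j) = low st j].

Definition load_slot r x := [:: IConst r (4 * x); IAdd r r 3; ILoad r r].
Definition store_slot x := [:: IConst 1 (4 * x); IAdd 1 1 3; IStore 1 0].
Definition load_counter r l :=
  [:: IConst r (4 * l + 2); IAdd r r 3; ILoad r r].
Definition store_counter l :=
  [:: IConst 1 (4 * l + 2); IAdd 1 1 3; IStore 1 0].
Definition tab_addr a :=
  load_slot 0 a ++
  [:: IAdd 0 0 0; IAdd 0 0 0; IAdd 0 0 3; IConst 1 1; IAdd 0 0 1].
(** With truncated subtraction, [x - (x - 2 * N)] equals [minn x (2 * N)], so the clamping needs no
    jump. *)
Definition low_addr a :=
  load_slot 0 a ++ load_counter 1 0 ++
  [:: IAdd 1 1 1; ISub 2 0 1; ISub 0 0 2; IConst 1 4; IAdd 0 0 1].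

(** Jump targets are absolute, hence the start address [i]. The number [l] counts the enclosing
    loops: a loop at depth [l] runs on counter [l.+1], which its body, compiled at depth [l.+1],
    leaves intact. *)
Fixpoint compile (c : cmd) (i l : nat) : seq instr :=
  match c with
  | CConst d k => IConst 0 k :: store_slot d
  | CAdd d a b =>
      load_slot 0 a ++ load_slot 1 b ++ IAdd 0 0 1 :: store_slot d
  | CSub d a b =>
      load_slot 0 a ++ load_slot 1 b ++ ISub 0 0 1 :: store_slot d
  | CTab d a => tab_addr a ++ ILoad 0 0 :: store_slot d
  | CTabSet a b => tab_addr a ++ load_slot 1 b ++ [:: IStore 0 1]
  | CLow d a => low_addr a ++ ILoad 0 0 :: store_slot d
  | CLowSet a b => low_addr a ++ load_slot 1 b ++ [:: IStore 0 1]
  | CSeq c1 c2 =>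
      let s1 := compile c1 i l in s1 ++ compile c2 (i + size s1) l
  | CIf a c1 c2 =>
      let s1 := compile c1 (i + 4) l in
      let s2 := compile c2 (i + 4 + size s1 + 1) l in
      load_slot 0 a ++ IJz 0 (i + 4 + size s1 + 1) :: s1 ++
      IJmp (i + 4 + size s1 + 1 + size s2) :: s2
  | CRep c1 =>
      let s1 := compile c1 (i + 15) l.+1 in
      load_counter 0 0 ++ store_counter l.+1 ++
      load_counter 0 l.+1 ++ IJz 0 (i + 15 + size s1 + 1) ::
      [:: IConst 1 1; ISub 0 0 1] ++ store_counter l.+1 ++
      s1 ++ [:: IJmp (i + 6)]
  end.

Ltac upd_tac :=
  repeat match goal with |- context [?a == ?b] =>
    first [ (have ->: (a == b) = false by lia)
          | (have ->: (a == b) = true by lia)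
          | case: (a =P b) => ? ] end.

Section Macros.
Variables (N B : nat) (st : state) (m : memory).
Hypothesis R : represents N B st m.

Let m3 : m 3 = B. Proof. by case: R => -[]. Qed.
Let Bge : 2 * N + 5 <= B. Proof. by case: R => -[]. Qed.
Let mN : m (B + 2) = N. Proof. by case: R. Qed.
Let ms x : m (B + 4 * x) = slot st x. Proof. by case: R. Qed.
Let mt x : m (B + 4 * x + 1) = tab st x. Proof. by case: R. Qed.
Let ml j : j <= 2 * N -> m (4 + j) = low st j. Proof. by case: R => _ _ _ _; apply. Qed.

Lemma represents_slot m' d v :
  (forall a, 2 < a -> m' a = upd m (B + 4 * d) v a) ->
  represents N B (set_slot st d v) m'.
Proof.
move=> H; split=> [||x|x|j jN] /=; rewrite H ?/upd; try lia; upd_tac => //; try lia.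
by rewrite ml.
Qed.

Lemma represents_tab m' d v :
  (forall a, 2 < a -> m' a = upd m (B + 4 * d + 1) v a) ->
  represents N B (set_tab st d v) m'.
Proof.
move=> H; split=> [||x|x|j jN] /=; rewrite H ?/upd; try lia; upd_tac => //; try lia.
by rewrite ml.
Qed.

Lemma represents_low m' d v : d <= 2 * N ->
  (forall a, 2 < a -> m' a = upd m (4 + d) v a) ->
  represents N B (set_low st d v) m'.
Proof.
move=> dN H; split=> [||x|x|j jN] /=; rewrite H ?/upd; try lia; upd_tac => //; try lia.
by rewrite ml.
Qed.

Lemma represents_scratch m' : (forall a, 2 < a -> m' a = m a) ->
  represents N B st m'.
Proof.
by move=> H; split=> [||x|x|j jN]; rewrite H //; try lia; apply: ml.
Qed.

Lemma exec_load_slot r x : r < 3 -> exists m',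
  [/\ exec_instrs m (load_slot r x) = m', represents N B st m',
      m' r = slot st x & forall a, a != r -> m' a = m a].
Proof.
move=> r3; eexists; split; first reflexivity.
- apply: represents_scratch => a a3.
  by rewrite /exec_instrs /= /upd; upd_tac.
- rewrite /exec_instrs /= /upd !eqxx.
  have ->: (3 == r) = false by lia.
  by rewrite m3 addnC; upd_tac.
- by move=> a /negPf ar; rewrite /exec_instrs /= /upd ar.
Qed.

Lemma exec_load_counter r l : r < 3 -> exists m',
  [/\ exec_instrs m (load_counter r l) = m', represents N B st m',
      m' r = m (B + 4 * l + 2) & forall a, a != r -> m' a = m a].
Proof.
move=> r3; eexists; split; first reflexivity.
- apply: represents_scratch => a a3.
  by rewrite /exec_instrs /= /upd; upd_tac.
- rewrite /exec_instrs /= /upd !eqxx.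
  have ->: (3 == r) = false by lia.
  by rewrite m3 addnC addnA; upd_tac.
- by move=> a /negPf ar; rewrite /exec_instrs /= /upd ar.
Qed.

Lemma exec_store_slot x a : 2 < a ->
  exec_instrs m (store_slot x) a = upd m (B + 4 * x) (m 0) a.
Proof.
move=> a3; rewrite /exec_instrs /= /upd /= m3 addnC.
by have ->: (a == 1) = false by lia.
Qed.

Lemma exec_store_counter l a : 2 < a ->
  exec_instrs m (store_counter l) a = upd m (B + 4 * l + 2) (m 0) a.
Proof.
move=> a3; rewrite /exec_instrs /= /upd /= m3 addnC addnA.
by have ->: (a == 1) = false by lia.
Qed.

Lemma exec_tab_addr x : exists m',
  [/\ exec_instrs m (tab_addr x) = m', represents N B st m',
      m' 0 = B + 4 * slot st x + 1 & forall a, 2 < a -> m' a = m a].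
Proof.
have [m1 [E1 R1 V1 S1]] := exec_load_slot x (isT : 0 < 3).
rewrite /tab_addr exec_instrs_cat E1.
have S: forall a, 2 < a -> exec_instrs m1 [:: IAdd 0 0 0; IAdd 0 0 0; IAdd 0 0 3; IConst 1 1; IAdd 0 0 1] a = m a.
  move=> a a3; rewrite /exec_instrs /= /upd; upd_tac; rewrite S1 //; lia.
eexists; split; first reflexivity; last exact: S.
- exact: represents_scratch.
- rewrite /exec_instrs /= /upd /= V1 S1 // m3; lia.
Qed.

Lemma exec_low_addr x : exists m',
  [/\ exec_instrs m (low_addr x) = m', represents N B st m',
      m' 0 = 4 + minn (slot st x) (2 * N) & forall a, 2 < a -> m' a = m a].
Proof.
have [m1 [E1 R1 V1 S1]] := exec_load_slot x (isT : 0 < 3).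
rewrite /low_addr /load_counter exec_instrs_cat E1.
set cs := _ ++ _.
have S: forall a, 2 < a -> exec_instrs m1 cs a = m a.
  move=> a a3; rewrite /exec_instrs /= /upd; upd_tac; rewrite S1 //; lia.
eexists; split; first reflexivity; last exact: S.
- exact: represents_scratch.
- have m13: m1 3 = B by rewrite S1.
  rewrite /exec_instrs /= /upd /= V1 m13.
  have -> : 4 * 0 + 2 + B = B + 2 by lia.
  by rewrite S1 ?mN; lia.
Qed.
End Macros.

Definition same_counters B (m m' : memory) (l : nat) :=
  forall j, j <= l -> m' (B + 4 * j + 2) = m (B + 4 * j + 2).

Fixpoint is_basic (c : cmd) :=
  match c with CSeq _ _ | CIf _ _ _ | CRep _ => false | _ => true end.

Lemma compile_basic_straight c i l : is_basic c -> all straight (compile c i l).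
Proof. by case: c. Qed.

Lemma exec_basic N B st m c i l : is_basic c -> represents N B st m ->
  let m' := exec_instrs m (compile c i l) in
  represents N B (exec N c st) m' /\ same_counters B m m' l.
Proof.
have m3 : forall m st, represents N B st m -> m 3 = B /\ 2 * N + 5 <= B.
  by move=> ? ? [[]].
move=> bc R; have [m3B Bge] := m3 _ _ R.
have slotP d v m' : (forall a, 2 < a -> m' a = upd m (B + 4 * d) v a) ->
  represents N B (set_slot st d v) m' /\ same_counters B m m' l.
  move=> H; split; first exact: (represents_slot R).
  by move=> j jl; rewrite H /upd; [upd_tac|lia].
have tabP d v m' : (forall a, 2 < a -> m' a = upd m (B + 4 * d + 1) v a) ->
  represents N B (set_tab st d v) m' /\ same_counters B m m' l.
  move=> H; split; first exact: (represents_tab R).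
  by move=> j jl; rewrite H /upd; [upd_tac|lia].
have lowP d v m' : d <= 2 * N -> (forall a, 2 < a -> m' a = upd m (4 + d) v a) ->
  represents N B (set_low st d v) m' /\ same_counters B m m' l.
  move=> dN H; split; first exact: (represents_low R).
  by move=> j jl; rewrite H /upd; [upd_tac|lia].
have storeP m1 c0 d v : represents N B st m1 -> (forall a, 2 < a -> m1 a = m a) ->
    (forall a, 2 < a -> exec_instr m1 c0 a = m1 a) -> exec_instr m1 c0 0 = v ->
  let m' := exec_instrs m1 (c0 :: store_slot d) in
  represents N B (set_slot st d v) m' /\ same_counters B m m' l.
  move=> R1 S1 S2 V m'; apply: slotP => a a3.
  have ->: m' = exec_instrs (exec_instr m1 c0) (store_slot d) by [].
  rewrite (exec_store_slot (represents_scratch R1 S2)) // V /upd.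
  by case: eqP => // _; rewrite S2 // S1.
case: c bc => [d k|d a b|d a b|d a|a b|d a|a b|||] bc;
  try (by move: bc); cbn [compile exec].
- apply: (storeP m) => [|||//] // a a3; rewrite /= /upd; upd_tac => //; lia.
- rewrite !exec_instrs_cat.
  have [m1 [-> R1 V1 S1]] := exec_load_slot R a (isT : 0 < 3).
  have [m2 [-> R2 V2 S2]] := exec_load_slot R1 b (isT : 1 < 3).
  apply: storeP => //=.
  + by move=> x x3; rewrite S2 ?S1 //; lia.
  + by move=> x x3; rewrite /upd; upd_tac.
  + by rewrite /upd /= V2 S2 // V1.
- rewrite !exec_instrs_cat.
  have [m1 [-> R1 V1 S1]] := exec_load_slot R a (isT : 0 < 3).
  have [m2 [-> R2 V2 S2]] := exec_load_slot R1 b (isT : 1 < 3).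
  apply: storeP => //=.
  + by move=> x x3; rewrite S2 ?S1 //; lia.
  + by move=> x x3; rewrite /upd; upd_tac.
  + by rewrite /upd /= V2 S2 // V1.
- rewrite exec_instrs_cat.
  have [m1 [-> R1 V1 S1]] := exec_tab_addr R a.
  apply: storeP => //=.
  + by move=> x x3; rewrite /upd; upd_tac.
  + by rewrite /upd /= V1; case: R1.
- rewrite exec_instrs_cat.
  have [m1 [-> R1 V1 S1]] := exec_tab_addr R a.
  rewrite exec_instrs_cat.
  have [m2 [-> R2 V2 S2]] := exec_load_slot R1 b (isT : 1 < 3).
  apply: tabP => x x3.
  rewrite /= S2 // V1 V2 /upd; case: eqP => // _.
  by rewrite S2 ?S1 //; lia.
- rewrite exec_instrs_cat.
  have [m1 [-> R1 V1 S1]] := exec_low_addr R a.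
  apply: storeP => //=.
  + by move=> x x3; rewrite /upd; upd_tac.
  + by rewrite /upd /= V1; case: R1 => _ _ _ _ ->; lia.
- rewrite exec_instrs_cat.
  have [m1 [-> R1 V1 S1]] := exec_low_addr R a.
  rewrite exec_instrs_cat.
  have [m2 [-> R2 V2 S2]] := exec_load_slot R1 b (isT : 1 < 3).
  apply: lowP => [|x x3]; first lia.
  rewrite /= S2 // V1 V2 /upd; case: eqP => // _.
  by rewrite S2 ?S1 //; lia.
Qed.

(** Both branches of [CIf] are charged, so the bound depends on [N] and the program text alone,
    never on the state. *)
Fixpoint time (N : nat) (c : cmd) : nat :=
  match c with
  | CSeq c1 c2 => time N c1 + time N c2
  | CIf _ c1 c2 => 5 + time N c1 + time N c2
  | CRep c1 => 20 + N * (20 + time N c1)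
  | _ => 20
  end.

Lemma time_poly c : exists a k, forall N, 0 < N -> time N c <= a * N ^ k.
Proof.
elim: c => [d k|d a b|d a b|d a|a b|d a|a b|c1 [a1 [k1 H1]] c2 [a2 [k2 H2]]|
            a c1 [a1 [k1 H1]] c2 [a2 [k2 H2]]|c [a [k H]]];
  try by exists 20, 0 => N N0; rewrite expn0.
- exists (a1 + a2), (k1 + k2) => N N0 /=.
  have h1 : N ^ k1 <= N ^ (k1 + k2) by rewrite leq_pexp2l ?leq_addr.
  have h2 : N ^ k2 <= N ^ (k1 + k2) by rewrite leq_pexp2l ?leq_addl.
  rewrite mulnDl; apply: leq_add.
    by apply: leq_trans (H1 N N0) _; rewrite leq_mul2l h1 orbT.
  by apply: leq_trans (H2 N N0) _; rewrite leq_mul2l h2 orbT.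
- exists (5 + a1 + a2), (k1 + k2) => N N0 /=.
  have h0 : 0 < N ^ (k1 + k2) by rewrite expn_gt0 N0.
  have h1 : N ^ k1 <= N ^ (k1 + k2) by rewrite leq_pexp2l ?leq_addr.
  have h2 : N ^ k2 <= N ^ (k1 + k2) by rewrite leq_pexp2l ?leq_addl.
  rewrite !mulnDl; apply: leq_add; first (apply: leq_add; first lia).
    by apply: leq_trans (H1 N N0) _; rewrite leq_mul2l h1 orbT.
  by apply: leq_trans (H2 N N0) _; rewrite leq_mul2l h2 orbT.
- exists (40 + a), k.+1 => N N0 /=.
  have h0 : 0 < N ^ k by rewrite expn_gt0 N0.
  have := H N N0; rewrite expnS; nia.
Qed.

Lemma step_jz p i m a l : nth IHalt p i = IJz a l ->
  run p 1 (Config i m) = Config (if m a == 0 then l else i.+1) m.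
Proof. by move=> /= E; rewrite /step /= E. Qed.

Lemma step_jmp p i m l : nth IHalt p i = IJmp l -> run p 1 (Config i m) = Config l m.
Proof. by move=> /= E; rewrite /step /= E. Qed.

Lemma same_counters_trans B m1 m2 m3 l :
  same_counters B m1 m2 l -> same_counters B m2 m3 l -> same_counters B m1 m3 l.
Proof. by move=> H1 H2 j jl; rewrite H2 ?H1. Qed.

Lemma same_counters_high N B st m m' l : represents N B st m ->
  (forall a, 2 < a -> m' a = m a) -> same_counters B m m' l.
Proof. by case=> -[_ ?] _ _ _ _ H j _; rewrite H //; lia. Qed.

Lemma code_at_head p i c cs : code_at p i (c :: cs) -> nth IHalt p i = c.
Proof. by move=> H; rewrite -[i]addn0 H. Qed.

Lemma code_at_tail p i c cs : code_at p i (c :: cs) -> code_at p i.+1 cs.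
Proof. by move=> H j lj; rewrite addSnnS H. Qed.

Lemma size_cons (T : Type) (x : T) s : size (x :: s) = (size s).+1.
Proof. by []. Qed.

Lemma run_block p i cs m k m' : all straight cs -> code_at p i cs ->
  size cs = k -> exec_instrs m cs = m' ->
  run p k (Config i m) = Config (i + k) m'.
Proof. by move=> sc H <- <-; apply: run_straight. Qed.

Lemma represents_counter N B st m m' l v : represents N B st m ->
  (forall a, 2 < a -> m' a = upd m (B + 4 * l.+1 + 2) v a) ->
  represents N B st m'.
Proof.
case=> -[m3 Bge] mN ms mt ml H.
by split=> [||x|x|j jN]; rewrite H ?/upd; try lia; upd_tac => //; try lia; apply: ml.
Qed.

(** Preservation of the counters up to [l] carries the induction through loops: a body has to return
    with the counter of its own loop unchanged. *)
Lemma compile_correct N B p c : forall st m i l,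
  represents N B st m -> code_at p i (compile c i l) ->
  exists t m', [/\ t <= time N c,
    run p t (Config i m) = Config (i + size (compile c i l)) m',
    represents N B (exec N c st) m' & same_counters B m m' l].
Proof.
have basic c0 : is_basic c0 -> time N c0 = 20 -> (forall i l, size (compile c0 i l) <= 20) -> forall st m i l,
  represents N B st m -> code_at p i (compile c0 i l) ->
  exists t m', [/\ t <= time N c0,
    run p t (Config i m) = Config (i + size (compile c0 i l)) m',
    represents N B (exec N c0 st) m' & same_counters B m m' l].
  move=> bc -> Hs st m i l R H.
  have [R' S'] := exec_basic i l bc R.
  exists (size (compile c0 i l)), (exec_instrs m (compile c0 i l)); split=> //.
  by rewrite run_straight // compile_basic_straight.
elim: c => [d k|d a b|d a b|d a|a b|d a|a b|c1 IH1 c2 IH2|a c1 IH1 c2 IH2|c IH];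
  try exact: basic.
- move=> st m i l R; cbn [compile exec time].
  move=> /code_at_cat [H1 H2].
  have [t1 [m1 [T1 E1 R1 S1]]] := IH1 _ _ _ _ R H1.
  have [t2 [m2 [T2 E2 R2 S2]]] := IH2 _ _ _ _ R1 H2.
  exists (t1 + t2), m2; split=> //; first by rewrite leq_add.
    by rewrite run_add E1 E2 size_cat addnA.
  exact: same_counters_trans S1 S2.
- move=> st m i l R; cbn [compile exec time].
  set s1 := compile c1 _ _; set s2 := compile c2 _ _.
  move=> /code_at_cat [H0]; rewrite [size (load_slot 0 a)]/= => H.
  have Hjz := code_at_head H; move: (code_at_tail H) => {H}.
  rewrite -addnS => /code_at_cat [H1] H.
  have Hjmp := code_at_head H; move: (code_at_tail H) => {H}; rewrite -addn1 => H2.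
  have [m0 [E0 R0 V0 S0]] := exec_load_slot R a (isT : 0 < 3).
  have S0' : same_counters B m m0 l.
    by apply: (same_counters_high R) => x x3; rewrite S0 //; lia.
  have Erun0 : run p 3 (Config i m) = Config (i + 3) m0.
    exact: run_block H0 _ E0.
  have Ejz := step_jz m0 Hjz.
  case: eqP V0 => Ha V0.
    have [t2 [m2 [T2 E2 R2 S2]]] := IH2 _ _ _ _ R0 H2.
    exists (3 + (1 + t2)), m2; split=> //; first by move: T2; clear; lia.
      rewrite !run_add Erun0 Ejz V0 Ha eqxx E2; congr Config.
      by rewrite -/s2 !(size_cat, size_cons) (_ : size [::] = 0) //; lia.
    exact: same_counters_trans S0' S2.
  have [t1 [m1 [T1 E1 R1 S1]]] := IH1 _ _ _ _ R0 H1.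
  exists (3 + (1 + (t1 + 1))), m1; split=> //; first by move: T1; clear; lia.
    rewrite !run_add Erun0 Ejz V0; case: eqP => // _.
    rewrite -addnS E1 (step_jmp _ Hjmp); congr Config.
    by rewrite !(size_cat, size_cons) (_ : size [::] = 0) //; lia.
  exact: same_counters_trans S0' S1.
- move=> st m i l R; cbn [compile exec time].
  set s1 := compile c _ _.
  move=> /code_at_cat [Ha] /code_at_cat [Hb] /code_at_cat [Hc].
  rewrite -!addnA [3 + _]/= [3 + _]/= => H.
  have Hjz := code_at_head H; move: (code_at_tail H) => {H}.
  rewrite -addnS => /code_at_cat [Hd] /code_at_cat [He].
  rewrite -!addnA [9.+1 + _]/= => /code_at_cat [Hs] /code_at_head Hjmp.
  have {}Hc : code_at p (i + 6) (load_counter 0 l.+1) by rewrite -addnA in Hc.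
  have {}Hjz : nth IHalt p (i + 9) = IJz 0 (i + 15 + size s1 + 1).
    by rewrite -2!addnA.
  have {}Hd : code_at p (i + 10) [:: IConst 1 1; ISub 0 0 1] by [].
  have {}He : code_at p (i + 12) (store_counter l.+1) by rewrite -addnA in He.
  have {}Hs : code_at p (i + 15) s1 by [].
  have {}Hjmp : nth IHalt p (i + 15 + size s1) = IJmp (i + 6) by [].
  have Bge : 2 * N + 5 <= B by case: R => -[].
  (* Induction on the counter value found at the loop head, address [i + 6]. *)
  have loop k : forall st m, represents N B st m -> m (B + 4 * l.+1 + 2) = k ->
    exists t m', [/\ t <= k * (20 + time N c) + 4,
      run p t (Config (i + 6) m) = Config (i + 15 + size s1 + 1) m',
      represents N B (iter k (exec N c) st) m' & same_counters B m m' l].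
    elim: k => [|k IHk] {R}{}st {}m R mk;
      have [m0 [E0 R0 V0 S0]] := exec_load_counter R l.+1 (isT : 0 < 3);
      have Erun0 : run p 3 (Config (i + 6) m) = Config (i + 9) m0
        by rewrite (run_block _ Hc _ E0) // -addnA.
      exists (3 + 1), m0; split=> //.
        by rewrite run_add Erun0 (step_jz _ Hjz) V0 mk.
      by apply: (same_counters_high R) => x x3; rewrite S0 //; lia.
    set m1 := exec_instrs m0 [:: IConst 1 1; ISub 0 0 1].
    have Erun1 : run p 2 (Config (i + 10) m0) = Config (i + 12) m1.
      by rewrite (run_block _ Hd _ (erefl m1)) // -addnA.
    have S1 : forall a, 2 < a -> m1 a = m0 a.
      by move=> a a3; rewrite /m1 /= /upd; upd_tac.
    have V1 : m1 0 = k by rewrite /m1 /= /upd /= V0 mk subn1.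
    have R1 := represents_scratch R0 S1.
    set m2 := exec_instrs m1 (store_counter l.+1).
    have Erun2 : run p 3 (Config (i + 12) m1) = Config (i + 15) m2.
      by rewrite (run_block _ He _ (erefl m2)) // -addnA.
    have S2 : forall a, 2 < a -> m2 a = upd m (B + 4 * l.+1 + 2) k a.
      move=> a a3; rewrite /m2 (exec_store_counter R1) // V1 /upd.
      by rewrite S1 // S0 //; lia.
    have R2 := represents_counter R S2.
    have [t3 [m3 [T3 E3 R3 S3]]] := IH _ _ _ _ R2 Hs.
    have mk3 : m3 (B + 4 * l.+1 + 2) = k.
      by rewrite S3 // S2 ?/upd ?eqxx; lia.
    have [t4 [m4 [T4 E4 R4 S4]]] := IHk _ _ R3 mk3.
    exists (3 + (1 + (2 + (3 + (t3 + (1 + t4)))))), m4; split.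
    + by rewrite mulSn; lia.
    + rewrite run_add Erun0 run_add (step_jz _ Hjz) V0 mk [_ == 0]/= -addnS.
      rewrite run_add Erun1 run_add Erun2 run_add E3.
      by rewrite run_add (step_jmp _ Hjmp).
    + by rewrite iterSr.
    + move=> j jl; rewrite S4 // S3 ?S2 ?/upd; try lia.
      by upd_tac.
  have [ma [Ea Ra Va Sa]] := exec_load_counter R 0 (isT : 0 < 3).
  have Eruna : run p 3 (Config i m) = Config (i + 3) ma.
    by rewrite (run_block _ Ha _ Ea).
  set mb := exec_instrs ma (store_counter l.+1).
  have Erunb : run p 3 (Config (i + 3) ma) = Config (i + 6) mb.
    by rewrite (run_block _ Hb _ (erefl mb)) // -addnA.
  have VN : ma 0 = N by rewrite Va; case: R => _ <- _ _ _; congr m; lia.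
  have Sb : forall a, 2 < a -> mb a = upd m (B + 4 * l.+1 + 2) N a.
    move=> a a3; rewrite /mb (exec_store_counter Ra) // VN /upd.
    by rewrite Sa //; lia.
  have Rb := represents_counter R Sb.
  have mbN : mb (B + 4 * l.+1 + 2) = N by rewrite Sb /upd ?eqxx //; lia.
  have [t [m' [T E R' S']]] := loop _ _ _ Rb mbN.
  exists (3 + (3 + t)), m'; split=> //; first lia.
    rewrite run_add Eruna run_add Erunb E; congr Config.
    by rewrite !(size_cat, size_cons) (_ : size [::] = 0) //; lia.
  move=> j jl; rewrite S' // Sb ?/upd; try lia.
  by upd_tac.
Qed.

(** * Setting up the frame and delivering the result *)

Definition prologue : program :=
  [:: IAdd 0 0 3; IAdd 3 0 0; IAdd 3 3 3; IAdd 3 3 3; IAdd 3 3 3;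
      IStore 3 1; IConst 1 1; IAdd 0 0 1; IConst 1 2; IAdd 1 1 3; IStore 1 0;
      IConst 1 4; IAdd 1 1 3; IStore 1 2].

Definition epilogue : program :=
  load_slot 1 4 ++ load_slot 2 5 ++ load_slot 0 6 ++ [:: ILoad 3 3; IHalt].

Definition ram_program (c : cmd) : program :=
  prologue ++ compile c (size prologue) 0 ++ epilogue.

Definition init_state n s t E : state :=
  State (fun x => if x == 0 then s else if x == 1 then t else 0) (fun _ => 0)
    (fun j => init_mem n s t E (4 + j)).

(** The base has to reach [2 * N + 5 = 2 * (n + size E) + 7] and is obtained by doubling
    [n + size E]. As this number can be 1, the factor 16 is the first power of two that suffices.
    All registers past the edge list are 0, so the remaining slots and the table start out
    cleared. *)
Lemma prologue_correct n s t E : 0 < n ->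
  represents (n + size E + 1) (16 * (n + size E)) (init_state n s t E)
    (exec_instrs (init_mem n s t E) prologue).
Proof.
move=> n0; set m := init_mem n s t E; set e := size E.
have m0 : m 0 = n by []. have m1 : m 1 = s by [].
have m2 : m 2 = t by []. have m3 : m 3 = e by [].
have mhi a : 4 + 2 * e <= a -> m a = 0.
  by move=> ha; rewrite /m /init_mem -/e; do 4 (case: eqP; first lia); case: ltnP; lia.
set B := 16 * (n + e); have B16 : 16 <= B by lia.
have -> : prologue = [:: IAdd 0 0 3; IAdd 3 0 0; IAdd 3 3 3; IAdd 3 3 3; IAdd 3 3 3] ++
  [:: IStore 3 1; IConst 1 1; IAdd 0 0 1; IConst 1 2; IAdd 1 1 3] ++
  [:: IStore 1 0; IConst 1 4; IAdd 1 1 3] ++ [:: IStore 1 2] by [].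
rewrite (exec_instrs_cat m).
have [ma Ea] : exists ma, ma = exec_instrs m
  [:: IAdd 0 0 3; IAdd 3 0 0; IAdd 3 3 3; IAdd 3 3 3; IAdd 3 3 3] by eexists.
rewrite -Ea (exec_instrs_cat ma).
have [a0 a1 a2 a3] : [/\ ma 0 = n + e, ma 1 = s, ma 2 = t & ma 3 = B].
  by split; rewrite Ea /= /upd //= m0 m3; lia.
have ahi a : 3 < a -> ma a = m a by move=> h; rewrite Ea /= /upd; upd_tac.
have [mb Eb] : exists mb, mb = exec_instrs ma
  [:: IStore 3 1; IConst 1 1; IAdd 0 0 1; IConst 1 2; IAdd 1 1 3] by eexists.
rewrite -Eb (exec_instrs_cat mb).
have [b0 b1 b2 b3] : [/\ mb 0 = n + e + 1, mb 1 = B + 2, mb 2 = t & mb 3 = B].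
  by split; rewrite Eb /= /upd /= a3; upd_tac; rewrite ?a0; lia.
have bhi a : 3 < a -> mb a = upd m B s a.
  by move=> h; rewrite Eb /= /upd a3 a1; upd_tac; rewrite ?ahi.
have [mc Ec] : exists mc, mc = exec_instrs mb
  [:: IStore 1 0; IConst 1 4; IAdd 1 1 3] by eexists.
rewrite -Ec.
have [c1 c2 c3] : [/\ mc 1 = B + 4, mc 2 = t & mc 3 = B].
  by split; rewrite Ec /= /upd /= b1; upd_tac; rewrite ?b3; lia.
have chi a : 3 < a -> mc a = upd (upd m B s) (B + 2) (n + e + 1) a.
  by move=> h; rewrite Ec /= /upd b1 b0; upd_tac; rewrite ?bhi // /upd; upd_tac.
have [md Ed] : exists md, md = exec_instrs mc [:: IStore 1 2] by eexists.
have dhi a : 3 < a -> md a = upd (upd (upd m B s) (B + 2) (n + e + 1)) (B + 4) t a.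
  by move=> h; rewrite Ed /= /upd c1 c2; upd_tac; rewrite ?chi // /upd; upd_tac.
rewrite -Ed.
split.
- by split; [rewrite Ed /= /upd c1; upd_tac | lia].
- by rewrite dhi /upd; [upd_tac | lia].
- by move=> x /=; rewrite dhi /upd; [upd_tac => //; apply: mhi; lia | lia].
- by move=> x /=; rewrite dhi /upd; [upd_tac => //; apply: mhi; lia | lia].
- by move=> x ? /=; rewrite dhi /upd; [upd_tac | lia].
Qed.

(* The output register r[3] is loaded last, as r[3] holds the frame base. *)
Lemma cmd_simulation c : exists a k, forall n s t E, 0 < n ->
  let N := n + size E + 1 in
  let st := exec N c (init_state n s t E) in
  let fin := run (ram_program c) (a * N ^ k) (init_config n s t E) in
  [/\ halted (ram_program c) fin,
      [/\ Defs.mem fin 0 = slot st 6, Defs.mem fin 1 = slot st 4,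
          Defs.mem fin 2 = slot st 5 & Defs.mem fin 3 = slot st 0]
    & forall j, j <= 2 * N -> Defs.mem fin (4 + j) = low st j].
Proof.
have [a [k T]] := time_poly c.
exists (a + 30), k => n s t E n0 N st fin.
have N0 : 0 < N by rewrite /N; lia.
set p := ram_program c in fin *.
pose m := init_mem n s t E; pose B := 16 * (n + size E).
have Hp : code_at p 0 prologue by apply: (@code_at_mid [::]).
have Hc : code_at p (size prologue) (compile c (size prologue) 0).
  exact: code_at_mid.
have He : code_at p (size prologue + size (compile c (size prologue) 0)) epilogue.
  by move: (@code_at_mid (prologue ++ compile c (size prologue) 0) epilogue [::]);
     rewrite cats0 size_cat -catA.
have R0 := prologue_correct s t E n0; rewrite -/N -/m -/B in R0.
have [tc [m1 [Tc E1 R1 _]]] := compile_correct R0 Hc.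
set i1 := _ + size _ in E1 He.
have [m2 [X2 R2 V2 S2]] := exec_load_slot R1 4 (isT : 1 < 3).
have [m3 [X3 R3 V3 S3]] := exec_load_slot R2 5 (isT : 2 < 3).
have [m4 [X4 R4 V4 S4]] := exec_load_slot R3 6 (isT : 0 < 3).
have Bge : 2 * N + 5 <= B by case: R0 => -[].
pose m5 := upd m4 3 (m4 (m4 3)).
pose blk := load_slot 1 4 ++ load_slot 2 5 ++ load_slot 0 6 ++ [:: ILoad 3 3].
have [Hb Hh] : code_at p i1 blk /\ code_at p (i1 + 10) [:: IHalt].
  exact: (@code_at_cat _ _ blk [:: IHalt]).
have Xb : exec_instrs m1 blk = m5.
  by rewrite /blk exec_instrs_cat X2 exec_instrs_cat X3 exec_instrs_cat X4.
have Xh : step p (Config (i1 + 10) m5) = None by rewrite /step [pc _]/= (code_at_head Hh).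
have Efin : fin = Config (i1 + 10) m5.
  rewrite /fin.
  have [f ->] : exists f, (a + 30) * N ^ k = size prologue + (tc + (10 + f)).
    exists ((a + 30) * N ^ k - (size prologue + (tc + 10))).
    have h := T N N0; have h1 : 0 < N ^ k by rewrite expn_gt0 N0.
    by move: Tc h h1; rewrite mulnDl [size _]/=; clear; lia.
  rewrite run_add (run_straight _ _ Hp) // run_add E1.
  by rewrite run_add (run_block _ Hb _ Xb) // run_stuck.
rewrite Efin; split; first by rewrite /halted Xh.
- split=> /=.
  + by rewrite /m5 /upd /= V4.
  + by rewrite /m5 /upd /= S4 // S3 // V2.
  + by rewrite /m5 /upd /= S4 // V3.
  + rewrite /m5 /upd /=; case: R4 => -[-> _] _ H _ _.
    by move: (H 0); rewrite muln0 addn0.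
- move=> j jN; rewrite /= /m5 /upd; case: eqP; first lia.
  by case: R4 => _ _ _ _ ->.
Qed.

(** * Expressions *)

Record ctx := Ctx { dim : nat; edge_word : nat -> nat; table : nat -> nat }.

(** [EFold] binds an index and an accumulator, and its number of rounds is a fixed power of [dim],
    so every expression is polynomial by construction. [EDrop] is weakening: it lets an argument be
    evaluated below an [ELet] without renaming its variables. *)
Inductive expr :=
  | EVar of nat
  | EConst of nat
  | EAdd of expr & expr
  | ESub of expr & expr
  | EIf of expr & expr & expr
  | EEdge of expr
  | ETab of expr
  | ELet of expr & expr
  | EDrop of expr
  | EFold of nat & expr & expr.

Fixpoint eval (G : ctx) (env : seq nat) (e : expr) : nat :=
  match e with
  | EVar i => nth 0 env i
  | EConst k => k
  | EAdd e1 e2 => eval G env e1 + eval G env e2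
  | ESub e1 e2 => eval G env e1 - eval G env e2
  | EIf e1 e2 e3 => if eval G env e1 == 0 then eval G env e3 else eval G env e2
  | EEdge e1 => edge_word G (eval G env e1)
  | ETab e1 => table G (eval G env e1)
  | ELet e1 e2 => eval G (eval G env e1 :: env) e2
  | EDrop e1 => eval G (behead env) e1
  | EFold k e0 e1 =>
      iteri (dim G ^ k) (fun i acc => eval G (i :: acc :: env) e1) (eval G env e0)
  end.

(* The value of [e] goes to slot [d]; [rho] lists the slots (all below [d])
   holding the environment. *)
Fixpoint compile_expr (rho : seq nat) (d : nat) (e : expr) : cmd :=
  match e with
  | EVar i =>
      if i < size rho then CSeq (CConst d 0) (CAdd d (nth 0 rho i) d)
      else CConst d 0
  | EConst k => CConst d k
  | EAdd e1 e2 =>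
      CSeq (compile_expr rho d e1)
        (CSeq (compile_expr rho d.+1 e2) (CAdd d d d.+1))
  | ESub e1 e2 =>
      CSeq (compile_expr rho d e1)
        (CSeq (compile_expr rho d.+1 e2) (CSub d d d.+1))
  | EIf e1 e2 e3 =>
      CSeq (compile_expr rho d e1)
        (CIf d (compile_expr rho d e2) (compile_expr rho d e3))
  | EEdge e1 => CSeq (compile_expr rho d e1) (CLow d d)
  | ETab e1 => CSeq (compile_expr rho d e1) (CTab d d)
  | ELet e1 e2 =>
      CSeq (compile_expr rho d e1)
        (CSeq (compile_expr (d :: rho) d.+1 e2)
          (CSeq (CConst d.+2 0) (CAdd d d.+1 d.+2)))
  | EDrop e1 => compile_expr (behead rho) d e1
  | EFold k e0 e1 =>
      CSeq (compile_expr rho d e0) (CSeq (CConst d.+1 0)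
        (iter k CRep
          (CSeq (compile_expr (d.+1 :: d :: rho) d.+2 e1)
            (CSeq (CConst d.+3 0) (CSeq (CAdd d d.+2 d.+3)
              (CSeq (CConst d.+3 1) (CAdd d.+1 d.+1 d.+3)))))))
  end.

Lemma exec_rep N k c st : exec N (iter k CRep c) st = iter (N ^ k) (exec N c) st.
Proof.
elim: k st => [|k IH] st //=; rewrite expnS.
have E : forall n st, iter n (exec N (iter k CRep c)) st = iter (n * N ^ k) (exec N c) st.
  by elim=> //= n IHn st'; rewrite IHn IH mulSn iterD.
exact: E.
Qed.

Definition ctx_of N st :=
  Ctx N (fun j => low st (minn j (2 * N))) (tab st).

Definition env_in (st : state) (rho env : seq nat) (d : nat) :=
  size rho = size env /\
  forall i, i < size rho -> nth 0 rho i < d /\ slot st (nth 0 rho i) = nth 0 env i.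

Lemma env_in_stable st st' rho env d d' : env_in st rho env d -> d <= d' ->
  (forall x, x < d -> slot st' x = slot st x) -> env_in st' rho env d'.
Proof.
case=> Hs H dd S; split=> // i lti; have [h1 h2] := H i lti.
by rewrite S //; split=> //; lia.
Qed.

Lemma env_in_cons st rho env d x : env_in st rho env d -> slot st d = x ->
  env_in st (d :: rho) (x :: env) d.+1.
Proof.
case=> Hs H dx; split=> [|[|i]] /=; first by rewrite Hs.
  by rewrite dx.
by rewrite ltnS => /H [h1 h2]; split=> //; lia.
Qed.

Definition computes N st st' d v :=
  [/\ slot st' d = v, forall x, x < d -> slot st' x = slot st x
    & ctx_of N st' = ctx_of N st /\ low st' = low st].

Lemma compile_expr_correct N e : forall rho env d st, env_in st rho env d ->
  computes N st (exec N (compile_expr rho d e) st) d (eval (ctx_of N st) env e).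
Proof.
elim: e => [i|k|e1 IH1 e2 IH2|e1 IH1 e2 IH2|e1 IH1 e2 IH2 e3 IH3|e1 IH1|e1 IH1|
   e1 IH1 e2 IH2|e1 IH1|k e0 IH0 e1 IH1] rho env d st H /=.
- case: ltnP => li; split=> //=; rewrite /upd ?eqxx.
  + have [h1 h2] := H.2 i li; have -> : (nth 0 rho i == d) = false by lia.
    by rewrite addn0.
  + by move=> x xd; have -> : (x == d) = false by lia.
  + by rewrite nth_default // -H.1.
  + by move=> x xd; have -> : (x == d) = false by lia.
- by split=> //= [|x xd]; rewrite /upd ?eqxx //; have -> : (x == d) = false by lia.
- have := IH1 _ _ _ _ H; set st1 := exec N _ st => -[V1 S1 [C1 L1]].
  have := IH2 _ _ _ _ (env_in_stable H (leqnSn d) S1).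
  set st2 := exec N _ st1 => -[V2 S2 [C2 L2]].
  split=> /= [|x xd|].
  + by rewrite /upd eqxx V2 S2 // V1 C1.
  + by rewrite /upd; have -> : (x == d) = false by [lia]; rewrite S2 ?S1 //; lia.
  + by rewrite -C1 -C2 L2 L1.
- have := IH1 _ _ _ _ H; set st1 := exec N _ st => -[V1 S1 [C1 L1]].
  have := IH2 _ _ _ _ (env_in_stable H (leqnSn d) S1).
  set st2 := exec N _ st1 => -[V2 S2 [C2 L2]].
  split=> /= [|x xd|].
  + by rewrite /upd eqxx V2 S2 // V1 C1.
  + by rewrite /upd; have -> : (x == d) = false by [lia]; rewrite S2 ?S1 //; lia.
  + by rewrite -C1 -C2 L2 L1.
- have := IH1 _ _ _ _ H; set st1 := exec N _ st => -[V1 S1 [C1 L1]].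
  have H1 := env_in_stable H (leqnn d) S1.
  rewrite V1 -C1; case: eqP => _.
  + have [V2 S2 [C2 L2]] := IH3 _ _ _ _ H1; split=> // [x xd|]; first by rewrite S2 ?S1.
    by rewrite C2 L2.
  + have [V2 S2 [C2 L2]] := IH2 _ _ _ _ H1; split=> // [x xd|]; first by rewrite S2 ?S1.
    by rewrite C2 L2.
- have [V1 S1 [C1 L1]] := IH1 _ _ _ _ H; split=> //= [|x xd].
  + by rewrite /upd eqxx V1 L1.
  + by rewrite /upd; have -> : (x == d) = false by [lia]; rewrite S1.
- have := IH1 _ _ _ _ H; set st1 := exec N _ st => -[V1 S1 [C1 L1]].
  split=> //= [|x xd].
  + by rewrite /upd eqxx V1; case: C1 => _ ->.
  + by rewrite /upd; have -> : (x == d) = false by [lia]; rewrite S1.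
- have := IH1 _ _ _ _ H; set st1 := exec N _ st => -[V1 S1 [C1 L1]].
  have := IH2 _ _ _ _ (env_in_cons (env_in_stable H (leqnn d) S1) V1).
  set st2 := exec N _ st1 => -[V2 S2 [C2 L2]].
  split=> /= [|x xd|].
  + rewrite /upd !eqxx; have -> : (d.+1 == d.+2) = false by lia.
    by rewrite V2 addn0 C1.
  + rewrite /upd; have -> : (x == d) = false by lia.
    by have -> : (x == d.+2) = false by [lia]; rewrite S2 ?S1 //; lia.
  + by rewrite -C1 -C2 L2 L1.
- apply: IH1; case: H => Hs H; split; first by rewrite !size_behead Hs.
  move=> i; rewrite size_behead => li; have := H i.+1; rewrite !nth_behead; apply.
  by lia.
- have := IH0 _ _ _ _ H; set st0 := exec N _ st => -[V0 S0 [C0 L0]].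
  rewrite exec_rep; set body := CSeq (compile_expr _ _ e1) _; set st1 := set_slot _ _ _.
  set f := fun i acc => _.
  have loop M : let st' := iter M (exec N body) st1 in
    [/\ slot st' d = iteri M f (eval (ctx_of N st) env e0), slot st' d.+1 = M,
        forall x, x < d -> slot st' x = slot st x
      & ctx_of N st' = ctx_of N st /\ low st' = low st].
    elim: M => [|M [V S F [C L]]] /=.
      split=> //=; rewrite /upd ?eqxx //.
        by have -> : (d == d.+1) = false by lia.
      by move=> x xd; have -> : (x == d.+1) = false by [lia]; rewrite S0.
    move: V S F C L; set sM := iter M _ _ => V S F C L.
    have HM := env_in_cons (env_in_cons (env_in_stable H (leqnn d) F) V) S.
    have := IH1 _ _ _ _ HM; set s2 := exec N _ sM => -[V2 S2 [C2 L2]].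
    split=> /= [||x xd|].
    + by rewrite /upd; upd_tac; rewrite V2 addn0 C.
    + by rewrite /upd; upd_tac; rewrite S2 // S addn1.
    + by rewrite /upd; upd_tac; rewrite S2 ?F //; lia.
    + by rewrite -C -C2 L2 L.
  by have [V S F CL] := loop (N ^ k).
Qed.

Lemma eval_ext G G' env e : dim G = dim G' -> edge_word G =1 edge_word G' ->
  table G =1 table G' -> eval G env e = eval G' env e.
Proof.
move=> D Ed T; elim: e env => [i|k|e1 IH1 e2 IH2|e1 IH1 e2 IH2|e1 IH1 e2 IH2 e3 IH3|
  e1 IH1|e1 IH1|e1 IH1 e2 IH2|e1 IH1|k e0 IH0 e1 IH1] env //=;
  rewrite ?IH1 ?IH2 ?IH3 ?Ed ?T //.
rewrite D IH0; move: (_ ^ _) => M.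
by apply: eq_iteri => i acc.
Qed.

(** * Filling the table and writing out the answer *)

Definition incr_slot d tmp := CSeq (CConst tmp 1) (CAdd d d tmp).

Definition fill_cmd K e :=
  CSeq (CConst 2 0) (iter K CRep (CSeq (compile_expr [:: 2; 0; 1] 3 e)
    (CSeq (CTabSet 2 3) (incr_slot 2 3)))).

Definition output_body o :=
  CSeq (compile_expr [:: 2; 0; 1] 3 o)
    (CSeq (CConst 4 4) (CSeq (CSub 4 2 4) (CSeq (CLowSet 4 3) (incr_slot 2 4)))).

Definition output_cmd o := CSeq (CConst 2 4) (CRep (output_body o)).

(** Compiled code works in r[0] to r[3], so their final values wait in slots 6, 4, 5 and 0. The
    targets 4, 5, 6, 7 ascend because evaluation into slot [d] preserves the slots below [d]. Slot 0
    sits at the frame base itself, which lets r[3] be loaded through its own content; since it also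
    holds [s], it is overwritten last. *)
Definition final_cmd o :=
  CSeq (CSeq (CConst 2 1) (compile_expr [:: 2; 0; 1] 4 o))
  (CSeq (CSeq (CConst 2 2) (compile_expr [:: 2; 0; 1] 5 o))
  (CSeq (CSeq (CConst 2 0) (compile_expr [:: 2; 0; 1] 6 o))
  (CSeq (CSeq (CConst 2 3) (compile_expr [:: 2; 0; 1] 7 o))
    (CSeq (CConst 8 0) (CAdd 0 7 8))))).

(** The table as seen while cell [p] is computed: the cells from [p] on still hold their initial
    0. *)
Definition below (T : nat -> nat) (p q : nat) : nat := if q < p then T q else 0.

(** Each cell is written once, in increasing order, so whatever an entry reads below [p] is already
    final. This turns the run of the program into a recursion equation for the finished table. *)
Lemma fill_correct N K e s t (st : state) :
  slot st 0 = s -> slot st 1 = t -> (forall q, tab st q = 0) ->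
  let st' := exec N (fill_cmd K e) st in
  [/\ slot st' 0 = s, slot st' 1 = t &
   forall p, p < N ^ K ->
     tab st' p = eval (Ctx N (edge_word (ctx_of N st)) (below (tab st') p)) [:: p; s; t] e].
Proof.
move=> Hs Ht H0; cbn [exec fill_cmd]; rewrite exec_rep.
set body := CSeq _ (CSeq _ _); set st0 := set_slot _ _ _.
suff loop M : let st' := iter M (exec N body) st0 in
  [/\ slot st' 0 = s, slot st' 1 = t, slot st' 2 = M, low st' = low st &
   (forall q, M <= q -> tab st' q = 0) /\
   forall p, p < M ->
     tab st' p = eval (Ctx N (edge_word (ctx_of N st)) (below (tab st') p)) [:: p; s; t] e].
  by case: (loop (N ^ K)) => ? ? _ _ [].
elim: M => [|M [S0 S1 S2 L [Z T]]] /=; first by split.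
move: S0 S1 S2 L Z T; set sM := iter M _ _ => S0 S1 S2 L Z T.
have HM : env_in sM [:: 2; 0; 1] [:: M; s; t] 3 by split=> // -[|[|[|]]].
have := compile_expr_correct N e HM; set s2 := exec N _ sM => -[V F [C L2]].
have C2 : tab s2 = tab sM by case: C.
split=> /=.
- by rewrite /upd /= F.
- by rewrite /upd /= F.
- by rewrite /upd /= F // S2 addn1.
- by rewrite L2.
have tE q : (if q == slot s2 2 then slot s2 3 else tab s2 q) =
    if q == M then eval (ctx_of N sM) [:: M; s; t] e else tab sM q.
  by rewrite F // S2 V C2.
split=> [q Mq|p]; rewrite /upd tE.
  by case: eqP; [lia | move=> _; apply: Z; lia].
rewrite ltnS leq_eqVlt; case: eqP => [-> _|pM /=].
  apply: eval_ext => //= q; first by rewrite L.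
  rewrite /below; case: ltnP => qM; last by rewrite Z.
  by rewrite tE; case: eqP => //; lia.
move=> ltpM; rewrite T //; apply: eval_ext => //= q.
by rewrite /below; case: ltnP => // qp; rewrite tE; case: eqP => //; lia.
Qed.

Section Output.
Variables (N s t : nat) (o : expr) (out : nat -> (nat -> nat) -> nat -> nat).
Hypothesis oE : forall G p, eval G [:: p; s; t] o = out (dim G) (table G) p.

Lemma eval_output st p d : slot st 0 = s -> slot st 1 = t -> 2 < d ->
  let st' := exec N (CSeq (CConst 2 p) (compile_expr [:: 2; 0; 1] d o)) st in
  [/\ slot st' d = out N (tab st) p, forall x, x < d -> x != 2 -> slot st' x = slot st x,
      tab st' = tab st & low st' = low st].
Proof.
move=> S0 S1 d2; cbn [exec]; set s1 := set_slot _ _ _.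
have H : env_in s1 [:: 2; 0; 1] [:: p; s; t] d by split=> // -[|[|[|]]] //=; split=> //; lia.
have [V F [C L]] := compile_expr_correct N o H; split=> //.
- by rewrite V oE.
- by move=> x xd /negPf x2; rewrite F //= /upd x2.
- by case: C.
Qed.

(** The answer overwrites the edge list, which is harmless because the value of [o] depends on the
    dimension and the table only. Slot 2 counts registers and therefore starts at 4. *)
Lemma output_correct st : slot st 0 = s -> slot st 1 = t ->
  let st' := exec N (output_cmd o) st in
  [/\ slot st' 0 = s, slot st' 1 = t, tab st' = tab st &
   forall j, j < N -> low st' j = out N (tab st) (4 + j)].
Proof.
move=> S0 S1; set st0 := set_slot st 2 4; set body := output_body o.
rewrite -[exec N (output_cmd o) st]/(iter N (exec N body) st0).
suff loop M : M <= N -> let st' := iter M (exec N body) st0 in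
  [/\ slot st' 0 = s, slot st' 1 = t, slot st' 2 = 4 + M, tab st' = tab st &
   forall j, j < M -> low st' j = out N (tab st) (4 + j)].
  by case: (loop N (leqnn N)).
elim: M => [|M IH] MN /=; first by split.
have [] := IH (ltnW MN); set sM := iter M _ _ => V0 V1 V2 T L.
have HM : env_in sM [:: 2; 0; 1] [:: 4 + M; s; t] 3 by split=> // -[|[|[|]]].
have := compile_expr_correct N o HM; set s2 := exec N _ sM => -[V F [C L2]].
have C2 : tab s2 = tab sM by case: C.
split=> /=.
- by rewrite /upd /= F.
- by rewrite /upd /= F.
- by rewrite /upd /= F // V2; lia.
- by rewrite C2.
move=> j jM; rewrite /upd /= F // V2.
have -> : minn (4 + M - 4) (2 * N) = M by lia.
case: eqP => [->|ne]; last by rewrite L2 L //; lia.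
by rewrite V oE /= T.
Qed.

Lemma final_correct st : slot st 0 = s -> slot st 1 = t ->
  let st' := exec N (final_cmd o) st in
  [/\ slot st' 6 = out N (tab st) 0, slot st' 4 = out N (tab st) 1,
      slot st' 5 = out N (tab st) 2, slot st' 0 = out N (tab st) 3 &
      low st' = low st].
Proof.
move=> S0 S1; rewrite /final_cmd; cbn beta iota delta [exec]; cbn zeta.
have := eval_output 1 S0 S1 (isT : 2 < 4); cbn [exec]; set s1 := exec N _ _ => -[V1 F1 T1 L1].
have := eval_output (st := s1) 2 _ _ (isT : 2 < 5); rewrite !F1 // => /(_ S0 S1).
cbn [exec]; set s2 := exec N _ (set_slot s1 _ _) => -[V2 F2 T2 L2].
have := eval_output (st := s2) 0 _ _ (isT : 2 < 6); rewrite !F2 // !F1 // => /(_ S0 S1).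
cbn [exec]; set s3 := exec N _ (set_slot s2 _ _) => -[V3 F3 T3 L3].
have := eval_output (st := s3) 3 _ _ (isT : 2 < 7); rewrite !F3 // !F2 // !F1 // => /(_ S0 S1).
cbn [exec]; set s4 := exec N _ (set_slot s3 _ _) => -[V4 F4 T4 L4].
split=> /=; rewrite /upd /=.
- by rewrite F4 // V3 T2 T1.
- by rewrite F4 // F3 // F2.
- by rewrite F4 // F3 // V2 T1.
- by rewrite V4 addn0 T3 T2 T1.
- by rewrite L4 L3 L2 L1.
Qed.
End Output.

Theorem table_program K e o out :
  (forall G p s t, eval G [:: p; s; t] o = out (dim G) (table G) p) ->
  exists (p : program) (a k : nat), forall n s t E, 0 < n ->
  let N := n + size E + 1 in
  let fin := run p (a * N ^ k) (init_config n s t E) in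
  halted p fin /\ exists T,
  (forall q, q < N ^ K ->
     T q = eval (Ctx N (fun j => init_mem n s t E (4 + minn j (2 * N))) (below T q))
             [:: q; s; t] e) /\
  (forall j, j < N + 4 -> Defs.mem fin j = out N T j).
Proof.
move=> oE; pose c := CSeq (fill_cmd K e) (CSeq (output_cmd o) (final_cmd o)).
have [a [k H]] := cmd_simulation c.
exists (ram_program c), a, k => n s t E n0 N fin.
have [hf [f0 f1 f2 f3] fl] := H n s t E n0; split=> //.
pose st := init_state n s t E.
have := @fill_correct N K e s t st erefl erefl (fun=> erefl).
set st1 := exec N _ st => -[A0 A1 AT].
have := @output_correct N s t o out (fun G p => oE G p s t) st1 A0 A1.
set st2 := exec N _ st1 => -[B0 B1 BT BL].
have := @final_correct N s t o out (fun G p => oE G p s t) st2 B0 B1.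
set st3 := exec N _ st2 => -[C0 C1 C2 C3 CL].
exists (tab st1); split=> // j jN.
move: f0 f1 f2 f3 fl; rewrite -/N -/fin.
have -> : exec N c (init_state n s t E) = st3 by [].
rewrite C0 C1 C2 C3 CL BT => f0 f1 f2 f3 fl.
case: j jN => [|[|[|[|j]]]] jN //.
by rewrite (fl j) ?BL //; lia.
Qed.

(** * Closure properties of computable functions *)

(** Closure properties are stated for functions that have some expression, not for expressions, so
    that the algorithm can be written as ordinary Rocq definitions. *)
Definition computable (f : ctx -> seq nat -> nat) :=
  exists e, forall G env, eval G env e = f G env.

Definition computable1 (h : ctx -> nat -> nat) :=
  computable (fun G env => h G (nth 0 env 0)).
Definition computable2 (h : ctx -> nat -> nat -> nat) :=
  computable (fun G env => h G (nth 0 env 0) (nth 0 env 1)).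
Definition computable3 (h : ctx -> nat -> nat -> nat -> nat) :=
  computable (fun G env => h G (nth 0 env 0) (nth 0 env 1) (nth 0 env 2)).

Definition bsum M (f : nat -> nat) := iteri M (fun i acc => acc + f i) 0.
(* [bmin M f] is the least positive value of [f] below [M], [0] if there is none. *)
Definition bmin M (f : nat -> nat) :=
  iteri M (fun i acc => if (f i != 0) && ((acc == 0) || (f i < acc)) then f i else acc) 0.
Definition blast M (P : nat -> bool) := iteri M (fun i acc => if P i then i else acc) 0.
Definition bhas M (P : nat -> bool) := 0 < bsum M (fun i => P i : nat).

Lemma bsumE M f : bsum M f = \sum_(0 <= i < M) f i.
Proof.
rewrite /bsum; elim: M => [|M IH] /=; first by rewrite big_nil.
by rewrite IH big_nat_recr.
Qed.

Lemma bminP M f :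
  (bmin M f = 0 /\ forall i, i < M -> f i = 0) \/
  (0 < bmin M f /\ (exists2 i, i < M & f i = bmin M f) /\
   forall i, i < M -> 0 < f i -> bmin M f <= f i).
Proof.
rewrite /bmin; elim: M => [|M IH] /=; first by left.
move: IH; set b := iteri M _ 0 => IH.
case: (posnP (f M)) => [f0|fpos].
  rewrite f0 /=; case: IH => [[b0 H]|[bp [[i iM fi] H]]]; [left|right].
    by split=> // i; rewrite ltnS leq_eqVlt => /orP[/eqP ->|/H].
  split=> //; split; first by exists i => //; lia.
  by move=> j; rewrite ltnS leq_eqVlt => /orP[/eqP ->|/H //]; rewrite f0.
rewrite /=; right; case: IH => [[b0 H]|[bp [[i iM fi] H]]].
  rewrite b0 eqxx /=; split=> //; split; first by exists M.
  by move=> j; rewrite ltnS leq_eqVlt => /orP[/eqP -> //|/H ->].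
have -> : (b == 0) = false by lia.
case: (ltnP (f M) b) => /= fb.
  split=> //; split; first by exists M.
  by move=> j; rewrite ltnS leq_eqVlt => /orP[/eqP -> //|/H h /h]; lia.
split=> //; split; first by exists i => //; lia.
by move=> j; rewrite ltnS leq_eqVlt => /orP[/eqP -> //|/H].
Qed.

Lemma blastP M (P : pred nat) : (exists2 i, i < M & P i) -> blast M P < M /\ P (blast M P).
Proof.
rewrite /blast; elim: M => [|M IH] [i] //= iM Pi.
case PM: (P M) => //; have ne: i != M by apply: contraFneq PM => <-.
have [|h1 h2] := IH _; first by exists i => //; lia.
by split=> //; lia.
Qed.

Lemma bhasP M (P : pred nat) : reflect (exists2 i, i < M & P i) (bhas M P).
Proof.
rewrite /bhas /bsum; apply: (iffP idP); elim: M => [|M IH] //=.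
- case PM: (P M) => /=; first by exists M.
  by rewrite addn0 => /IH[i iM Pi]; exists i => //; lia.
- by case.
- case=> i; rewrite ltnS leq_eqVlt => /orP[/eqP -> -> /=|iM Pi]; first by rewrite addn1.
  by apply: (leq_trans (IH _)); [exists i | rewrite leq_addr].
Qed.

Section Closure.
Implicit Types f g h : ctx -> seq nat -> nat.
Implicit Types P Q : ctx -> seq nat -> bool.

Lemma comp_var i : computable (fun _ env => nth 0 env i).
Proof. by exists (EVar i). Qed.

Lemma comp_var_drop2 i : computable (fun _ env => nth 0 (behead (behead env)) i).
Proof. by exists (EDrop (EDrop (EVar i))). Qed.

Lemma comp_const k : computable (fun _ _ => k).
Proof. by exists (EConst k). Qed.

Lemma comp_add f g : computable f -> computable g ->
  computable (fun G env => f G env + g G env).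
Proof. by case=> e He [e' He']; exists (EAdd e e') => G env /=; rewrite He He'. Qed.

Lemma comp_sub f g : computable f -> computable g ->
  computable (fun G env => f G env - g G env).
Proof. by case=> e He [e' He']; exists (ESub e e') => G env /=; rewrite He He'. Qed.

Lemma comp_edge f : computable f -> computable (fun G env => edge_word G (f G env)).
Proof. by case=> e He; exists (EEdge e) => G env /=; rewrite He. Qed.

Lemma comp_table f : computable f -> computable (fun G env => table G (f G env)).
Proof. by case=> e He; exists (ETab e) => G env /=; rewrite He. Qed.

Lemma comp_if P f g : computable (fun G env => P G env : nat) ->
  computable f -> computable g ->
  computable (fun G env => if P G env then f G env else g G env).
Proof.
case=> e He [e' He'] [e'' He'']; exists (EIf e e' e'') => G env /=.
by rewrite He He' He''; case: (P G env).
Qed.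

Lemma comp_eqv f g : (forall G env, f G env = g G env) -> computable f -> computable g.
Proof. by move=> E [e He]; exists e => G env; rewrite He. Qed.

Lemma comp_leq f g : computable f -> computable g ->
  computable (fun G env => (f G env <= g G env) : nat).
Proof.
move=> cf cg; apply: (@comp_eqv (fun G env => 1 - (f G env - g G env))).
  by move=> G env; case: leqP; lia.
exact: comp_sub (comp_const 1) (comp_sub cf cg).
Qed.

Lemma comp_lt f g : computable f -> computable g ->
  computable (fun G env => (f G env < g G env) : nat).
Proof. by move=> cf cg; apply: comp_leq cg; apply: (comp_add (comp_const 1) cf). Qed.

Lemma comp_not P : computable (fun G env => P G env : nat) ->
  computable (fun G env => (~~ P G env) : nat).
Proof.
move=> c; apply: (@comp_eqv (fun G env => 1 - P G env)).
  by move=> G env; case: (P G env).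
exact: comp_sub (comp_const 1) c.
Qed.

Lemma comp_and P Q : computable (fun G env => P G env : nat) ->
  computable (fun G env => Q G env : nat) ->
  computable (fun G env => (P G env && Q G env) : nat).
Proof.
move=> cP cQ; apply: comp_eqv (comp_if cP cQ (comp_const 0)) => G env.
by case: (P G env).
Qed.

Lemma comp_or P Q : computable (fun G env => P G env : nat) ->
  computable (fun G env => Q G env : nat) ->
  computable (fun G env => (P G env || Q G env) : nat).
Proof.
move=> cP cQ; apply: comp_eqv (comp_if cP (comp_const 1) cQ) => G env.
by case: (P G env).
Qed.

Lemma comp_eq f g : computable f -> computable g ->
  computable (fun G env => (f G env == g G env) : nat).
Proof.
move=> cf cg; apply: comp_eqv (comp_and (comp_leq cf cg) (comp_leq cg cf)) => G env.
by rewrite eqn_leq.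
Qed.

Lemma comp_iteri k (F : ctx -> seq nat -> nat -> nat -> nat) f :
  computable (fun G env => F G (behead (behead env)) (nth 0 env 0) (nth 0 env 1)) ->
  computable f ->
  computable (fun G env => iteri (dim G ^ k) (F G env) (f G env)).
Proof.
case=> e1 H1 [e0 H0]; exists (EFold k e0 e1) => G env /=; rewrite H0.
by apply: eq_iteri => i acc; rewrite H1.
Qed.

End Closure.

Lemma comp_app1 h f : computable1 h -> computable f ->
  computable (fun G env => h G (f G env)).
Proof. by case=> e He [ef Hf]; exists (ELet ef e) => G env /=; rewrite He Hf. Qed.

Lemma comp_app2 h f g : computable2 h -> computable f -> computable g ->
  computable (fun G env => h G (f G env) (g G env)).
Proof.
case=> e He [ef Hf] [eg Hg]; exists (ELet eg (ELet (EDrop ef) e)) => G env /=.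
by rewrite He Hf Hg.
Qed.

Lemma comp_app3 h f g k : computable3 h -> computable f -> computable g -> computable k ->
  computable (fun G env => h G (f G env) (g G env) (k G env)).
Proof.
case=> e He [ef Hf] [eg Hg] [ek Hk].
exists (ELet ek (ELet (EDrop eg) (ELet (EDrop (EDrop ef)) e))) => G env /=.
by rewrite He Hf Hg Hk.
Qed.
Section Bounded.
Variable k : nat.

Lemma comp_bsum2 h : computable3 h ->
  computable2 (fun G a b => bsum (dim G ^ k) (fun i => h G i a b)).
Proof.
move=> ch; apply: (@comp_iteri k
  (fun G env i acc => acc + h G i (nth 0 env 0) (nth 0 env 1))); last exact: comp_const.
apply: comp_add; first exact: comp_var.
by apply: (comp_app3 ch (comp_var 0)); exact: comp_var_drop2.
Qed.

Lemma comp_bsum1 h : computable2 h ->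
  computable1 (fun G a => bsum (dim G ^ k) (fun i => h G i a)).
Proof.
move=> ch; apply: (@comp_iteri k
  (fun G env i acc => acc + h G i (nth 0 env 0))); last exact: comp_const.
apply: comp_add; first exact: comp_var.
by apply: (comp_app2 ch (comp_var 0)); exact: comp_var_drop2.
Qed.

Lemma comp_bhas2 (P : ctx -> nat -> nat -> nat -> bool) :
  computable3 (fun G i a b => P G i a b : nat) ->
  computable2 (fun G a b => bhas (dim G ^ k) (fun i => P G i a b) : nat).
Proof. by move=> cP; apply: (comp_lt (comp_const 0)); apply: comp_bsum2 cP. Qed.

Lemma comp_bmin2 h : computable3 h ->
  computable2 (fun G a b => bmin (dim G ^ k) (fun i => h G i a b)).
Proof.
move=> ch; pose F G env i acc := let v := h G i (nth 0 env 0) (nth 0 env 1) in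
  if (v != 0) && ((acc == 0) || (v < acc)) then v else acc.
apply: (@comp_iteri k F); last exact: comp_const.
have cv : computable (fun G env => h G (nth 0 env 0) (nth 0 (behead (behead env)) 0)
    (nth 0 (behead (behead env)) 1)).
  by apply: (comp_app3 ch (comp_var 0)); exact: comp_var_drop2.
apply: comp_if (comp_var 1) => //; apply: comp_and.
  by apply: comp_not; apply: comp_eq (comp_const 0).
apply: comp_or; first exact: comp_eq (comp_var 1) (comp_const 0).
exact: comp_lt (comp_var 1).
Qed.

Lemma comp_blast2 (P : ctx -> nat -> nat -> nat -> bool) :
  computable3 (fun G i a b => P G i a b : nat) ->
  computable2 (fun G a b => blast (dim G ^ k) (fun i => P G i a b)).
Proof.
move=> cP; pose F G env i (acc : nat) := 
  if P G i (nth 0 env 0) (nth 0 env 1) then i else acc.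
apply: (@comp_iteri k F); last exact: comp_const.
apply: comp_if (comp_var 0) (comp_var 1).
by apply: (comp_app3 cP (comp_var 0)); exact: comp_var_drop2.
Qed.
End Bounded.

(** * The dynamic program as a table of expressions *)

Section Algorithm.
Variable W' : nat.
Let W := W'.+1.
Let K := W.+2.

Definition scale N k a := bsum (N ^ k) (fun _ => a).
(* Division by [N ^ k], correct below [N ^ K] only. *)
Definition quo N k a := bsum (N ^ K) (fun j => (scale N k (j + 1) <= a) : nat).
Definition residue N k a := a - scale N k (quo N k a).

Definition edge_match G i u v :=
  ((edge_word G (i + i) == u) && (edge_word G (i + i + 1) == v)) ||
  ((edge_word G (i + i) == v) && (edge_word G (i + i + 1) == u)).
Definition adj_code G u v := (u != v) && bhas (dim G) (fun i => edge_match G i u v).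
Definition nbhd_code G u y := (u == y) || adj_code G u y.

Fixpoint in_window m G w y :=
  if m is m'.+1 then
    nbhd_code G (residue (dim G) 1 w) y || in_window m' G (quo (dim G) 1 w) y
  else false.

Definition fresh G w x :=
  bsum (dim G) (fun y => (nbhd_code G x y && ~~ in_window W G w y) : nat).
(** The residue drops the oldest vertex of the window; multiplying by [N] makes room for the new
    one. *)
Definition shift N w x := scale N 1 (residue N W' w) + x.
(** The value 0 is reserved for unreachable. A step costs [N] for each newly covered vertex, plus 1
    as the tie-breaker by length. *)
Definition candidate G x q w :=
  if adj_code G (residue (dim G) 1 w) x then
    if table G (q + shift (dim G) w x) == 0 then 0
    else table G (q + shift (dim G) w x) + (scale (dim G) 1 (fresh G w x) + 1)
  else 0.
Definition best G q w := bmin (dim G) (fun x => candidate G x q w).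
Definition layer_entry G p t :=
  if p < scale (dim G) W 1 then (residue (dim G) 1 p == t) : nat
  else best G (p - scale (dim G) W 1 - residue (dim G) W p) (residue (dim G) W p).

(** The walk starts as if it had already waited at [s] for a whole window. All windows then have the
    same length, and repetitions of [s] do not change a neighbourhood. *)
Fixpoint pad m N s := if m is m'.+1 then scale N 1 (pad m' N s) + s else 0.
Definition opt_key G s :=
  bmin (dim G) (fun i => table G (scale (dim G) W i + pad W (dim G) s)).
Definition opt_len G s :=
  if opt_key G s == 0 then 0
  else blast (dim G)
    (fun i => table G (scale (dim G) W i + pad W (dim G) s) == opt_key G s) + 1.
Definition next_vertex G q w :=
  blast (dim G) (fun x => candidate G x q w == table G (q + scale (dim G) W 1 + w)).

Definition base N := scale N W.+1 1.
(** Window number [l] is in cell [base + 1 + l]. If the answer has [v] vertices, [v - 1 - l] steps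
    remain there, so the window after it, in cell [p = base + 2 + l], is chosen by the values of
    layer [v - 2 - l]. *)
Definition window_entry G p :=
  shift (dim G) (table G (p - 1))
    (next_vertex G
      (scale (dim G) W (table G (base (dim G)) - 2 - (p - (base (dim G) + 2))))
      (table G (p - 1))).
(* A window is coded in base [N], the latest vertex being the lowest digit. Cell
   [N ^ W * i + w] describes the walks of [i] steps from window [w] to [t]; cell
   [base N] holds the number of vertices of the answer ([0] if there is none), and
   the next cells the successive windows along it. *)
Definition entry G p s t :=
  if p < base (dim G) then layer_entry G p t
  else if p == base (dim G) then opt_len G s
  else if p == base (dim G) + 1 then pad W (dim G) s
  else window_entry G p.
Definition out N T p :=
  if p == 0 then T (base N) else residue N 1 (T (base N + p)).

Ltac comp_step :=
  first [assumption | lazymatch goal with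
  | |- computable (fun _ env => nth 0 env ?i) => exact: comp_var
  | |- computable (fun _ _ => ?k) => exact: comp_const
  | |- computable (fun G env => @?f G env + @?g G env) => apply: (@comp_add f g)
  | |- computable (fun G env => @?f G env - @?g G env) => apply: (@comp_sub f g)
  | |- computable (fun G env => table G (@?f G env)) => apply: (@comp_table f)
  | |- computable (fun G env => edge_word G (@?f G env)) => apply: (@comp_edge f)
  | |- computable (fun _ _ => if _ then _ else _) => apply: comp_if
  | |- computable (fun G env => nat_of_bool (~~ @?P G env)) => apply: (@comp_not P)
  | |- computable (fun G env => nat_of_bool (@?P G env && @?Q G env)) =>
      apply: (@comp_and P Q)
  | |- computable (fun G env => nat_of_bool (@?P G env || @?Q G env)) =>
      apply: (@comp_or P Q)
  | |- computable (fun G env => nat_of_bool (@?f G env == @?g G env)) =>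
      apply: (@comp_eq f g)
  | |- computable (fun G env => nat_of_bool (@?f G env < @?g G env)) =>
      apply: (@comp_lt f g)
  | |- computable (fun G env => nat_of_bool (@?f G env <= @?g G env)) =>
      apply: (@comp_leq f g)
  | |- computable1 _ => progress cbv beta delta [computable1]
  | |- computable2 _ => progress cbv beta delta [computable2]
  | |- computable3 _ => progress cbv beta delta [computable3]
  end].
Ltac comp := repeat comp_step.

Lemma comp_scale k : computable1 (fun G a => scale (dim G) k a).
Proof. by apply: (@comp_bsum1 k (fun _ _ a => a)); comp. Qed.

Lemma comp_quo k : computable1 (fun G a => quo (dim G) k a).
Proof.
apply: (@comp_bsum1 K (fun G j a => (scale (dim G) k (j + 1) <= a) : nat)).
by comp; apply: (comp_app1 (comp_scale k)); comp.
Qed.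

Lemma comp_residue k : computable1 (fun G a => residue (dim G) k a).
Proof.
rewrite /computable1 /residue; comp; apply: (comp_app1 (comp_scale k)); exact: comp_quo.
Qed.

Lemma comp_adj_code : computable2 (fun G u v => adj_code G u v : nat).
Proof.
apply: comp_and; first by comp.
by apply: (@comp_bhas2 1 (fun G i u v => edge_match G i u v)); rewrite /edge_match; comp.
Qed.

Lemma comp_nbhd_code : computable2 (fun G u v => nbhd_code G u v : nat).
Proof. by rewrite /computable2 /nbhd_code; comp; apply: comp_adj_code. Qed.

Lemma comp_in_window m : computable2 (fun G w y => in_window m G w y : nat).
Proof.
elim: m => [|m IH]; first exact: comp_const 0.
apply: comp_or.
  by apply: (comp_app2 comp_nbhd_code); comp; exact: (comp_residue 1).
by apply: (comp_app2 IH); comp; exact: (comp_quo 1).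
Qed.

Lemma comp_fresh : computable2 (fun G w x => fresh G w x).
Proof.
apply: (@comp_bsum2 1 (fun G y w x => (nbhd_code G x y && ~~ in_window W G w y) : nat)).
comp; first by apply: (comp_app2 comp_nbhd_code); comp.
by apply: (comp_app2 (comp_in_window W)); comp.
Qed.

Lemma comp_shift : computable2 (fun G w x => shift (dim G) w x).
Proof.
by rewrite /computable2 /shift; comp; apply: (comp_app1 (comp_scale 1)); exact: (comp_residue W').
Qed.

Lemma comp_candidate : computable3 candidate.
Proof.
have ct : computable (fun G env => table G (nth 0 env 1 + shift (dim G) (nth 0 env 2) (nth 0 env 0))).
  by comp; apply: (comp_app2 comp_shift); comp.
rewrite /computable3 /candidate; comp.
  by apply: (comp_app2 comp_adj_code); comp; apply: (comp_app1 (comp_residue 1)); comp.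
by apply: (comp_app1 (comp_scale 1)); apply: (comp_app2 comp_fresh); comp.
Qed.

Lemma comp_best : computable2 best.
Proof. exact: (@comp_bmin2 1 candidate comp_candidate). Qed.

Lemma comp_layer_entry : computable2 layer_entry.
Proof.
have c1 := comp_app1 (comp_scale W) (comp_const 1).
rewrite /computable2 /layer_entry; comp; first exact: (comp_residue 1).
by apply: (comp_app2 comp_best); comp; exact: (comp_residue W).
Qed.

Lemma comp_pad m : computable1 (fun G s => pad m (dim G) s).
Proof.
elim: m => [|m IH]; first exact: comp_const 0.
by rewrite /computable1 /=; comp; apply: (comp_app1 (comp_scale 1)).
Qed.

Lemma comp_key_entry : computable3
  (fun G i s _ => table G (scale (dim G) W i + pad W (dim G) s)).
Proof.
comp; first by apply: (comp_app1 (comp_scale W)); comp.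
by apply: (comp_app1 (comp_pad W)); comp.
Qed.

Lemma comp_opt_key : computable1 opt_key.
Proof.
exact: (comp_app2 (@comp_bmin2 1 _ comp_key_entry) (comp_var 0) (comp_const 0)).
Qed.

Lemma comp_opt_len : computable1 opt_len.
Proof.
rewrite /computable1 /opt_len; comp; try exact: comp_opt_key.
have cP : computable3 (fun G i s key =>
    (table G (scale (dim G) W i + pad W (dim G) s) == key) : nat).
  comp; first by apply: (comp_app1 (comp_scale W)); comp.
  by apply: (comp_app1 (comp_pad W)); comp.
exact: (comp_app2 (comp_blast2 1 cP) (comp_var 0) comp_opt_key).
Qed.

Lemma comp_next_vertex : computable2 next_vertex.
Proof.
apply: (@comp_blast2 1 (fun G x q w => candidate G x q w == table G (q + scale (dim G) W 1 + w))).
comp; first exact: comp_candidate.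
exact: (comp_app1 (comp_scale W) (comp_const 1)).
Qed.

Lemma comp_base : computable (fun G _ => base (dim G)).
Proof. exact: (comp_app1 (comp_scale W.+1) (comp_const 1)). Qed.

Lemma comp_window_entry : computable1 window_entry.
Proof.
have cb := comp_base.
apply: (comp_app2 comp_shift); first by comp.
apply: (comp_app2 comp_next_vertex); last by comp.
by apply: (comp_app1 (comp_scale W)); comp.
Qed.

Lemma comp_entry : computable3 entry.
Proof.
have cb := comp_base.
rewrite /computable3 /entry; comp.
- by apply: (comp_app2 comp_layer_entry); comp.
- by apply: (comp_app1 comp_opt_len); comp.
- by apply: (comp_app1 (comp_pad W)); comp.
- by apply: (comp_app1 comp_window_entry); comp.
Qed.

Lemma comp_out : computable1 (fun G p => out (dim G) (table G) p).
Proof.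
have cb := comp_base.
rewrite /computable1 /out; comp.
by apply: (comp_app1 (comp_residue 1)); comp.
Qed.

Lemma algorithm_program : exists (p : program) (a k : nat), forall n s t E, 0 < n ->
  let N := n + size E + 1 in
  let fin := run p (a * N ^ k) (init_config n s t E) in
  halted p fin /\ exists T,
  (forall q, q < N ^ K ->
     T q = entry (Ctx N (fun j => init_mem n s t E (4 + minn j (2 * N))) (below T q)) q s t) /\
  (forall j, j < N + 4 -> Defs.mem fin j = out N T j).
Proof.
have [e He] := comp_entry; have [o Ho] := comp_out.
have [|p [a [k H]]] := @table_program K e o out; first by move=> *; rewrite Ho.
exists p, a, k => n s t E n0 N fin; have [hf [T [HT Hout]]] := H n s t E n0.
by split=> //; exists T; split=> // q /HT ->; rewrite He.
Qed.
End Algorithm.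

(** * Locality of minimal walks *)

Lemma adj_sym E u v : adj E u v = adj E v u.
Proof. by rewrite /adj eq_sym orbC. Qed.

Lemma adj_lt n E u v : wf_graph n E -> adj E u v -> u < n /\ v < n.
Proof.
by move=> /allP wf /andP[_ /orP[] /wf /and3P[]].
Qed.

Definition nbhd E u y := (u == y) || adj E u y.

Lemma count_orI (T : Type) (a b : pred T) s :
  count (fun y => a y || b y) s = count b s + count (fun y => a y && ~~ b y) s.
Proof. by elim: s => //= y s ->; case: (a y); case: (b y) => /=; lia. Qed.

Lemma cost_sub n E (P Q : seq nat) : {subset P <= Q} -> cost n E P <= cost n E Q.
Proof.
move=> PQ; apply: sub_count => y /hasP[u uP nuy].
by apply/hasP; exists u => //; apply: PQ.
Qed.

Definition new_nbrs n E (h : seq nat) x :=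
  count (fun y => nbhd E x y && ~~ has (fun u => nbhd E u y) h) (iota 0 n).

Lemma cost_eq_mem n E (P Q : seq nat) : P =i Q -> cost n E P = cost n E Q.
Proof.
by move=> PQ; apply/eqP; rewrite eqn_leq !cost_sub // => z; rewrite PQ.
Qed.

Lemma cost_cons n E x h : cost n E (x :: h) = cost n E h + new_nbrs n E h x.
Proof. by rewrite /cost /new_nbrs -count_orI. Qed.

(* The weight of the continuation [xs] of a walk with reversed history [h],
   when only the last [W] vertices are remembered. *)
Fixpoint weight n E W (h xs : seq nat) : nat :=
  if xs is x :: xs' then new_nbrs n E (take W h) x + weight n E W (x :: h) xs' else 0.

Lemma weight_cons n E W h x xs :
  weight n E W h (x :: xs) = new_nbrs n E (take W h) x + weight n E W (x :: h) xs.
Proof. by []. Qed.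

(** Forgetting part of the history can only make more vertices count as new. *)
Lemma cost_le_weight n E W h xs :
  cost n E (catrev xs h) <= cost n E h + weight n E W h xs.
Proof.
elim: xs h => [|x xs IH] h /=; first by rewrite addn0.
apply: leq_trans (IH _) _; rewrite cost_cons addnA leq_add2r leq_add2l.
apply: sub_count => y /andP[-> /=]; apply: contra => /hasP[u uh nuy].
by apply/hasP; exists u => //; apply: mem_take uh.
Qed.

(** Under this hypothesis a forgotten vertex shares no closed neighbour with the new one, so
    forgetting it miscounts nothing. *)
Lemma weight_eq_cost n E W h xs :
  (forall a x b, xs = a ++ x :: b -> forall u y, u \in catrev a h ->
     nbhd E u y -> nbhd E x y -> u \in take W (catrev a h)) ->
  cost n E (catrev xs h) = cost n E h + weight n E W h xs.
Proof.
elim: xs h => [|x xs IH] h H /=; first by rewrite addn0.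
rewrite IH => [|a z b Exs u y]; last by apply: (H (x :: a) z b); rewrite Exs.
rewrite cost_cons addnA; congr (_ + _ + _); apply: eq_count => y /=.
case nxy: (nbhd E x y) => //=; congr (~~ _); apply/idP/idP => /hasP[u uh nuy].
  by apply/hasP; exists u => //; apply: (H [::] x xs erefl u y).
by apply/hasP; exists u => //; apply: mem_take uh.
Qed.

(** This is what allows the table to be indexed by windows instead of whole histories. *)
Lemma weight_take n E W h h' xs : take W.+1 h = take W.+1 h' ->
  weight n E W.+1 h xs = weight n E W.+1 h' xs.
Proof.
elim: xs h h' => //= x xs IH h h' E0; rewrite E0; congr (_ + _); apply: IH => /=.
have tk (l : seq nat) : take W l = take W (take W.+1 l) by rewrite -take_min (minn_idPl (leqnSn W)).
by rewrite (tk h) (tk h') E0.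
Qed.

Section MinimalWalk.
Variables (n D : nat) (E : edge_list) (s t N : nat).
Hypothesis wf : wf_graph n E.
Hypothesis ltsn : s < n.
Hypothesis degD : max_degree_le n E D.
Hypothesis N0 : 0 < N.

Definition walk (P : seq nat) :=
  if P is x :: q then [&& x == s, path (adj E) x q & last x q == t] else false.

Definition potential P := N * cost n E P + size P.

Lemma walk_lt P : walk P -> all (fun x => x < n) P.
Proof.
case: P => // x q /and3P[/eqP -> pq _] /=; rewrite ltsn /=.
elim: q s pq => //= y q IH x0 /andP[axy pq].
by rewrite (adj_lt wf axy).2 (IH _ pq).
Qed.

Lemma walk_reroute A u M x b M' : walk (A ++ u :: M ++ x :: b) ->
  path (adj E) u (rcons M' x) -> walk (A ++ u :: M' ++ x :: b).
Proof.
move=> + pM.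
have tail : path (adj E) u (M ++ x :: b) -> path (adj E) u (M' ++ x :: b) /\
    last u (M' ++ x :: b) = last u (M ++ x :: b).
  by rewrite -!cat_rcons !cat_path pM !last_cat !last_rcons => /andP[_ ->].
case: A => [|a A] /=; first by case/and3P=> -> /tail[-> ->].
by rewrite !cat_path !last_cat /= => /and3P[-> /and3P[-> -> /tail[-> ->]]].
Qed.

Lemma walk_simple P : walk P -> exists2 Q, walk Q &
  [/\ uniq Q, {subset Q <= P} & size Q <= size P].
Proof.
case: P => // x q /and3P[/eqP -> pq lq]; move: lq.
case/shortenP: pq => q' pq' uq' sub lq'.
have sub' : {subset s :: q' <= s :: q}.
  by move=> z; rewrite !inE => /orP[->|/sub ->]; rewrite ?orbT.
exists (s :: q'); first by rewrite /= eqxx pq' lq'.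
by split=> //; apply: uniq_leq_size.
Qed.

Lemma potential_lt P Q : {subset Q <= P} -> size Q < size P -> potential Q < potential P.
Proof.
by move=> QP ?; rewrite /potential -addnS leq_add // leq_mul2l cost_sub ?orbT.
Qed.

Variable P : seq nat.
Hypothesis wP : walk P.
Hypothesis minP : forall Q, walk Q -> potential P <= potential Q.

Lemma minimal_uniq : uniq P.
Proof.
have [Q wQ [uQ sQP lQ]] := walk_simple wP.
apply: (leq_size_uniq uQ sQP).
by rewrite leqNgt; apply/negP => /(potential_lt sQP); rewrite ltnNge minP.
Qed.

(** A chord would be a shortcut: it drops the vertices of [M], so the cost does not grow while the
    length shrinks. *)
Lemma minimal_induced A u M x b : P = A ++ u :: M ++ x :: b -> adj E u x -> M = [::].
Proof.
move=> EP aux.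
have wQ : walk (A ++ u :: x :: b).
  by move: wP; rewrite EP => /(@walk_reroute _ _ _ _ _ [::]); apply; rewrite /= aux.
have sub : {subset A ++ u :: x :: b <= P}.
  move=> z; rewrite EP !(mem_cat, inE).
  by case/or4P=> ->; rewrite ?orbT.
case: M EP => // m M EP; have /(potential_lt sub) : size (A ++ u :: x :: b) < size P.
  by rewrite EP !size_cat /= !size_cat /=; lia.
by rewrite ltnNge minP.
Qed.

Lemma nbhd_card y : y < n -> count (nbhd E y) (iota 0 n) <= D.+1.
Proof.
move=> yn; have -> : count (nbhd E y) (iota 0 n) =
    count (fun z => adj E y z || pred1 y z) (iota 0 n).
  by apply: eq_count => z; rewrite /nbhd orbC eq_sym.
rewrite count_orI; apply: (@leq_add _ _ 1 D).
  by rewrite count_uniq_mem ?iota_uniq // leq_b1.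
apply: leq_trans (degD yn); apply: sub_count => z /= /andP[] //.
Qed.

(** Each vertex of [F] lies in its own closed neighbourhood, hence in that of [Q], and is not
    counted by [R]. *)
Lemma cost_add_disjoint Q R F : uniq F -> all (fun x => x < n) F ->
  {subset R <= Q} -> {subset F <= Q} ->
  (forall z, z \in F -> ~~ in_closed_nbhd E R z) ->
  cost n E R + size F <= cost n E Q.
Proof.
move=> uF /allP Fn RQ FQ FR.
have -> : size F = count (fun z => z \in F) (iota 0 n).
  rewrite -size_filter; apply: perm_size; apply: uniq_perm => //.
    exact: filter_uniq (iota_uniq _ _).
  move=> z; rewrite mem_filter mem_iota /=; case zF: (z \in F) => //=.
  by rewrite add0n (Fn z zF).
rewrite /cost; elim: (iota 0 n) => //= z l IH.
have : (in_closed_nbhd E R z : nat) + (z \in F) <= in_closed_nbhd E Q z.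
  case zF: (z \in F).
    rewrite (negbTE (FR z zF)) /=; suff -> : in_closed_nbhd E Q z by [].
    by apply/hasP; exists z; [apply: FQ | rewrite eqxx].
  rewrite addn0; case inR: (in_closed_nbhd E R z) => //.
  suff -> : in_closed_nbhd E Q z by [].
  by case/hasP: inR => w wR nw; apply/hasP; exists w => //; apply: RQ.
by move=> h; rewrite addnACA; apply: leq_add h IH.
Qed.

(* Otherwise rerouting from [u] to [x] through the common neighbour [y] would
   be cheaper: [P] is induced, so all but the two ends of [M] lie outside the
   neighbourhood of the rest of [P], while [y] adds at most [D + 1] vertices. *)
Lemma minimal_local A u M x b y : P = A ++ u :: M ++ x :: b ->
  nbhd E u y -> nbhd E x y -> size M <= D + 3.
Proof.
move=> EP nuy nxy.
have uP := minimal_uniq; have Pn := walk_lt wP.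
pose R := A ++ u :: x :: b.
pose F := [seq z <- M | ~~ in_closed_nbhd E R z].
have memP z : (z \in P) = [|| z \in A, z == u, z \in M, z == x | z \in b].
  by rewrite EP !(mem_cat, inE).
have memR z : (z \in R) = [|| z \in A, z == u, z == x | z \in b].
  by rewrite /R !(mem_cat, inE).
have MP z : z \in M -> z \in P by rewrite memP => ->; rewrite !orbT.
have RP z : z \in R -> z \in P.
  by rewrite memR memP; case/or4P=> ->; rewrite ?orbT.
have uM : uniq M by move: uP; rewrite EP cat_uniq /= cat_uniq => /and5P[_ _ _ ->].
have MR z : z \in M -> z \notin R.
  move=> zM; rewrite memR; apply/negP => H.
  move: uP; rewrite EP -cat_rcons uniq_catCA cat_uniq => /and3P[_ /hasP H' _].
  apply: H'; exists z => //; rewrite mem_cat mem_rcons !inE.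
  by case/or4P: H => ->; rewrite ?orbT.
have costP : cost n E R + size F <= cost n E P.
  apply: cost_add_disjoint => //.
  - exact: filter_uniq.
  - apply/allP => z; rewrite mem_filter => /andP[_ /MP zP].
    by move/allP: Pn; apply.
  - by move=> z; rewrite mem_filter => /andP[_ /MP].
  - by move=> z; rewrite mem_filter => /andP[].
(* Chords being excluded, an edge from [M] to [R] is an edge of the path. The cases place its end
   [w] in [A], at [u], at [x] or in [b]; the first and last are impossible, the other two make [z]
   an end of [M]. *)
have ends z : z \in M -> in_closed_nbhd E R z -> z \in [:: head u M; last u M].
  move=> zM /hasP[w wR]; have := MR _ zM.
  case: eqP => [<-|_ zR /= awz]; first by rewrite wR.
  move: wR; rewrite memR; case/splitPr: zM EP => M1 M3 EP.
  case/or4P => [|/eqP Ew|/eqP Ew|].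
  - move=> wA; case/splitPr: wA EP => A1 A2 EP.
    have := @minimal_induced A1 w (A2 ++ u :: M1) z (M3 ++ x :: b).
    rewrite EP -?catA /= -?catA /= => /(_ erefl awz).
    by case: (A2).
  - subst w; have := @minimal_induced A u M1 z (M3 ++ x :: b).
    by rewrite EP -?catA /= -?catA /= => /(_ erefl awz) -> /=; rewrite inE eqxx.
  - subst w; have := @minimal_induced (A ++ u :: M1) z M3 x b.
    rewrite EP -?catA /= -?catA /= => /(_ erefl); rewrite adj_sym => /(_ awz) ->.
    by rewrite last_cat !inE eqxx orbT.
  - move=> wb; case/splitPr: wb EP => b1 b2 EP.
    have := @minimal_induced (A ++ u :: M1) z (M3 ++ x :: b1) w b2.
    rewrite EP -?catA /= -?catA /= => /(_ erefl); rewrite adj_sym => /(_ awz).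
    by case: (M3).
have sizeF : size M <= size F + 2.
  rewrite -(count_predC (fun z => ~~ in_closed_nbhd E R z) M) size_filter leq_add2l.
  rewrite -size_filter; apply: (@uniq_leq_size _ _ [:: head u M; last u M]).
    exact: filter_uniq.
  by move=> z; rewrite mem_filter /= negbK => /andP[inR zM]; apply: ends.
have ux : u != x.
  have : u \notin M ++ x :: b by move: uP; rewrite EP cat_uniq => /and3P[_ _ /andP[]].
  by apply: contra => /eqP ->; rewrite mem_cat inE eqxx orbT.
(* If [y] is [u] or [x], then [u] and [x] are adjacent and the detour is a single edge. *)
have [M' [lM' sM' pM']] : exists M', [/\ size M' <= 1, {subset M' <= [:: y]} &
    path (adj E) u (rcons M' x)].
  case: (u =P y) => [Euy|/eqP uy].
    exists [::]; split=> //=; rewrite andbT Euy adj_sym.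
    by move: nxy; rewrite /nbhd -Euy eq_sym (negbTE ux).
  case: (x =P y) => [Exy|/eqP xy].
    by exists [::]; split=> //=; rewrite andbT; move: nuy; rewrite Exy /nbhd (negbTE uy).
  exists [:: y]; split=> //=; move: nuy nxy; rewrite /nbhd (negbTE uy) (negbTE xy) /=.
  by move=> -> ayx; rewrite adj_sym ayx.
have wQ : walk (A ++ u :: M' ++ x :: b) by move: wP; rewrite EP => /walk_reroute; apply.
have yn : y < n.
  have un : u < n by move/allP: Pn; apply; rewrite memP eqxx orbT.
  by case/orP: nuy => [/eqP <- //|/(adj_lt wf) []].
have costQ : cost n E (A ++ u :: M' ++ x :: b) <= cost n E R + D.+1.
  apply: (@leq_trans (cost n E (y :: R))).
    apply: cost_sub => z; rewrite [z \in y :: R]inE memR !(inE, mem_cat).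
    by case/or4P=> [->|->|/sM'|/orP[->|->]]; rewrite ?orbT // inE => ->.
  rewrite cost_cons leq_add2l; apply: leq_trans (nbhd_card yn).
  by apply: sub_count => z /andP[].
have sP : size P = size A + size M + size b + 2 by rewrite EP !size_cat /= !size_cat /=; clear; lia.
have := minP wQ; rewrite /potential sP leqNgt; apply: contraNleq => lM.
set Q := A ++ _ in costQ *.
have sQ : size Q = size A + size M' + size b + 2 by rewrite !size_cat /= !size_cat /=; clear; lia.
(* If [size M >= D + 4], then [size F >= D + 2], so [cost Q <= cost R + D + 1 < cost R + size F <=
   cost P]. *)
have ltQP : cost n E Q < cost n E P.
  by move: costQ costP sizeF lM; clear; lia.
have := leq_mul (leqnn N) ltQP; rewrite mulnS sQ; clear -N0 lM lM'.
move: (N * _) (N * _); lia.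
Qed.

Lemma minimal_weight W p : P = s :: p -> D + 3 < W ->
  cost n E P = cost n E [:: s] + weight n E W (nseq W s) p.
Proof.
move=> EP DW.
have costn k h : cost n E (h ++ nseq k.+1 s) = cost n E (h ++ [:: s]).
  by apply: cost_eq_mem => z; rewrite !mem_cat mem_nseq inE.
have [k Wk] : exists k, W = k.+1 by exists W.-1; lia.
have -> : cost n E [:: s] = cost n E (nseq W s) by rewrite Wk (costn k [::]).
rewrite -weight_eq_cost.
  rewrite catrevE Wk costn EP; apply: cost_eq_mem => z.
  by rewrite !(mem_cat, mem_rev, inE) orbC.
move=> a x b Ep u y; rewrite catrevE => uh nuy nxy.
(* Here [a] is the part of the walk between the initial [s] and [x]. If it is shorter than [W], the
   window shows all of it and a copy of [s]. Otherwise a vertex [u] outside the window would have at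
   least [W > D + 3] vertices between itself and [x], against [minimal_local]. *)
case: (leqP W (size a)) => Wa; last first.
  rewrite take_cat size_rev ltnNge (ltnW Wa) /=.
  move: uh; rewrite !mem_cat => /orP[->//|]; rewrite mem_nseq => /andP[_ /eqP ->].
  by rewrite take_nseq ?leq_subr // mem_nseq eqxx subn_gt0 Wa orbT.
rewrite take_cat size_rev ltn_neqAle Wa andbT.
apply/negPn/negP => uW.
have uW' : u \notin take W (rev a).
  move: uW; case: eqP => [Ea|//]; rewrite mem_cat negb_or => /andP[+ _].
  by rewrite Ea take_oversize ?size_rev.
have us : u \in s :: take (size a - W) a.
  move: uh; rewrite mem_cat mem_nseq inE => /orP[|/andP[_ ->]//].
  rewrite -{1}(cat_take_drop W (rev a)) mem_cat (negbTE uW') /=.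
  by rewrite drop_rev mem_rev => ->; rewrite orbT.
have [A [M [EA lM]]] : exists A M, s :: a = A ++ u :: M /\ W <= size M.
  have -> : s :: a = (s :: take (size a - W) a) ++ drop (size a - W) a.
    by rewrite /= cat_take_drop.
  case/splitPr: us => A M; exists A, (M ++ drop (size a - W) a); split.
    by rewrite -catA.
  by rewrite size_cat size_drop subKn // leq_addl.
have : P = A ++ u :: M ++ x :: b by rewrite EP Ep -(cat_cons s a) EA -catA.
by move=> /minimal_local /(_ nuy nxy); rewrite leqNgt (leq_trans DW lM).
Qed.
End MinimalWalk.

(** * Correctness of the dynamic program *)

Lemma exists_minimal (T : Type) (p : T -> bool) (f : T -> nat) x0 : p x0 ->
  exists2 x, p x & forall y, p y -> f x <= f y.
Proof.
have [m] := ubnP (f x0); elim: m x0 => // m IH x0 fm px.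
case: (classic (exists2 y, p y & f y < f x0)) => [[y py fy]|no].
  by apply: (IH y) => //; apply: leq_trans fy _.
by exists x0 => // y py; rewrite leqNgt; apply/negP => fy; apply: no; exists y.
Qed.

(** * Windows as numbers in base [N] *)

Fixpoint digits N m w := if m is m'.+1 then w %% N :: digits N m' (w %/ N) else [::].

Section Codes.
Variables (N W' : nat).
Hypothesis N0 : 0 < N.
Let W := W'.+1.
Let K := W.+2.

Lemma bsum_const M a : bsum M (fun _ => a) = M * a.
Proof. by rewrite bsumE sum_nat_const_nat subn0. Qed.

Lemma scaleE k a : scale N k a = N ^ k * a.
Proof. exact: bsum_const. Qed.

Lemma bsum_lt M a : bsum M (fun j => (j < a) : nat) = minn M a.
Proof.
rewrite /bsum; elim: M => [|M IH] /=; first by rewrite min0n.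
by rewrite IH; case: ltnP; lia.
Qed.

Lemma bsum_ext M f g : (forall i, i < M -> f i = g i) -> bsum M f = bsum M g.
Proof. by move=> fg; rewrite !bsumE; apply: eq_big_nat => i /andP[_ /fg]. Qed.

Lemma quoE k a : a < N ^ K -> quo W' N k a = a %/ N ^ k.
Proof.
move=> aK; have Nk : 0 < N ^ k by rewrite expn_gt0 N0.
(* The summand tests [N ^ k * (j + 1) <= a], that is [j < a %/ N ^ k], and [a < N ^ K] makes the
   range long enough to count all such [j]. *)
rewrite /quo (@bsum_ext _ _ (fun j => (j < a %/ N ^ k) : nat)).
  by rewrite bsum_lt; apply/minn_idPr; apply: leq_trans (leq_div _ _) (ltnW aK).
by move=> j _; rewrite scaleE addn1 mulnC -leq_divRL.
Qed.

Lemma residueE k a : a < N ^ K -> residue W' N k a = a %% N ^ k.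
Proof.
move=> aK; rewrite /residue quoE // scaleE mulnC.
by rewrite {1}(divn_eq a (N ^ k)) addKn.
Qed.

Lemma ltn_expK w : w < N ^ W -> w < N ^ K.
Proof. by move=> h; apply: leq_trans h _; rewrite leq_pexp2l // /K; lia. Qed.

Lemma digits_modn m w : digits N m (w %% N ^ m) = digits N m w.
Proof.
elim: m w => //= m IH w; rewrite expnS modn_dvdm ?dvdn_mulr //.
by rewrite [N * _]mulnC -modn_divl IH.
Qed.

Lemma digits_step m a x : x < N -> digits N m.+1 (N * a + x) = x :: digits N m a.
Proof.
by move=> xN; rewrite /= mulnC modnMDl modn_small // divnMDl // divn_small // addn0.
Qed.

Lemma take_digits m k w : m <= k -> take m (digits N k w) = digits N m w.
Proof. by elim: m k w => [|m IH] [|k] w //= mk; rewrite IH. Qed.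

Lemma size_digits m w : size (digits N m w) = m.
Proof. by elim: m w => //= m IH w; rewrite IH. Qed.

Lemma shiftE w x : w < N ^ W -> shift W' N w x = N * (w %% N ^ W') + x.
Proof. by move=> wW; rewrite /shift scaleE residueE ?expn1 // ltn_expK. Qed.

Lemma shift_lt w x : w < N ^ W -> x < N -> shift W' N w x < N ^ W.
Proof.
move=> wW xN; rewrite shiftE // /W expnS.
have : w %% N ^ W' < N ^ W' by rewrite ltn_mod expn_gt0 N0.
nia.
Qed.

Lemma digits_shift w x : w < N ^ W -> x < N ->
  digits N W (shift W' N w x) = take W (x :: digits N W w).
Proof.
move=> wW xN; rewrite shiftE // digits_step // digits_modn.
by rewrite -[take W _]/(x :: take W' (digits N W w)) take_digits ?leqnSn.
Qed.

Lemma shift_mod w x : w < N ^ W -> x < N -> shift W' N w x %% N = x.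
Proof. by move=> wW xN; rewrite shiftE // mulnC modnMDl modn_small. Qed.

Lemma padP m s : s < N -> pad m N s < N ^ m /\ digits N m (pad m N s) = nseq m s.
Proof.
move=> sN; elim: m => [|m [IH1 IH2]]; first by rewrite expn0.
rewrite [pad _ _ _]/= scaleE expn1 digits_step // IH2; split=> //.
rewrite expnS; nia.
Qed.
End Codes.

(** * Reading adjacency and new neighbours from the input *)

Section Adjacency.
Variables (n s t : nat) (E : edge_list) (T : nat -> nat) (W' : nat).
Let N := n + size E + 1.
Let W := W'.+1.
Let K := W.+2.
Hypothesis wf : wf_graph n E.
Let G := Ctx N (fun j => init_mem n s t E (4 + minn j (2 * N))) T.

Let edge_wordE i : i < N ->
  edge_word G (i + i) = (nth (0, 0) E i).1 /\ edge_word G (i + i + 1) = (nth (0, 0) E i).2.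
Proof.
(* From [i < N] both indices are below [2 * N], so the clamp is inactive. *)
move=> iN /=; have -> : minn (i + i) (2 * N) = i + i by lia.
have -> : minn (i + i + 1) (2 * N) = i + i + 1 by lia.
rewrite /init_mem; do 4 ((case: eqP; first lia) => _).
do 4 ((case: eqP; first lia) => _); rewrite !addKn.
have -> : odd (i + i) = false by lia.
have -> : odd (i + i + 1) by lia.
have -> : (i + i)./2 = i by lia.
have -> : (i + i + 1)./2 = i by lia.
have -> : (4 + (i + i) < 4 + 2 * size E) = (i < size E) by lia.
have -> : (4 + (i + i + 1) < 4 + 2 * size E) = (i < size E) by lia.
by case: ltnP => // h; rewrite nth_default.
Qed.

(* Indices past the edge list read the pair (0, 0), which is not an edge. *)
Lemma adj_codeE u v : adj_code G u v = adj E u v.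
Proof.
rewrite /adj_code /adj; case: eqP => //= uv; apply/bhasP/idP.
  case=> i iN; rewrite /edge_match; have [-> ->] := edge_wordE iN.
  case: (ltnP i (size E)) => iE; last first.
    by rewrite nth_default //= => /orP[] /andP[/eqP h /eqP h']; case: uv; rewrite -h -h'.
  have := mem_nth (0, 0) iE; case: (nth _ _ _) => a b /= ab.
  by case/orP=> /andP[/eqP <- /eqP <-]; rewrite ab ?orbT.
have idx e : e \in E -> exists2 i, i < N & nth (0, 0) E i = e.
  move=> eE; exists (index e E); last exact: nth_index.
  by move: eE; rewrite -index_mem => /leq_trans; apply; rewrite /N addn1 ltnW // ltnS leq_addl.
case/orP=> /idx [i iN Ei]; exists i => //; rewrite /edge_match;
  have [-> ->] := edge_wordE iN; by rewrite Ei !eqxx ?orbT.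
Qed.

Lemma nbhd_codeE u v : nbhd_code G u v = nbhd E u v.
Proof. by rewrite /nbhd_code adj_codeE. Qed.

Let N0 : 0 < N. Proof. by rewrite /N addn1. Qed.

Lemma in_windowE m w y : w < N ^ K ->
  in_window W' m G w y = has (fun u => nbhd E u y) (digits N m w).
Proof.
elim: m w => //= m IH w wK; rewrite nbhd_codeE residueE // quoE // expn1 IH //.
by apply: leq_ltn_trans wK; exact: leq_div.
Qed.

(** The program counts over all [y < N], the only range its loops have; the surplus from [n] on
    contributes nothing, since edges and [x] lie below [n]. *)
Lemma freshE w x : w < N ^ W -> x < n ->
  fresh W' G w x = new_nbrs n E (digits N W w) x.
Proof.
move=> wW xn; rewrite /fresh /new_nbrs.
set P := fun y => _ && _.
have -> : bsum N (fun y => (nbhd_code G x y && ~~ in_window W' W G w y) : nat) =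
    count P (iota 0 N).
  rewrite bsumE -sum1_count [RHS]big_mkcond /index_iota subn0.
  by apply: eq_bigr => y _; rewrite nbhd_codeE (@in_windowE W) ?ltn_expK.
have -> : N = n + (size E + 1) by rewrite /N addnA.
rewrite iotaD count_cat [X in _ + X](_ : _ = 0) ?addn0 //.
apply/eqP; rewrite -leqn0 leqNgt -has_count; apply/hasPn => y.
rewrite mem_iota add0n => /andP[ny _]; rewrite /P /nbhd.
case: eqP => [xy|_]; first by lia.
case axy: (adj E x y) => //=; have := (adj_lt wf axy).2; lia.
Qed.
End Adjacency.

Lemma bmin_ext M f g : (forall i, i < M -> f i = g i) -> bmin M f = bmin M g.
Proof.
rewrite /bmin; elim: M => //= M IH fg; rewrite fg // IH // => i iM.
by apply: fg; apply: ltnW.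
Qed.

Lemma blast_ext M (P Q : pred nat) :
  (forall i, i < M -> P i = Q i) -> blast M P = blast M Q.
Proof.
rewrite /blast; elim: M => //= M IH PQ; rewrite PQ // IH // => i iM.
by apply: PQ; apply: ltnW.
Qed.

Local Arguments digits : simpl never.

(** * Optimal values and the walk read off the table *)

Section Correctness.
Variables (n D s t : nat) (E : edge_list) (T : nat -> nat).
Hypotheses (wf : wf_graph n E) (ltsn : s < n).
Hypothesis degD : max_degree_le n E D.
Let N := n + size E + 1.
Let W' := D + 3.
Let W := W'.+1.
Let K := W.+2.
Let M := N ^ W.
Let R := N ^ W.+1.
Let ctx_at p := Ctx N (fun j => init_mem n s t E (4 + minn j (2 * N))) (below T p).
Hypothesis HT : forall p, p < N ^ K -> T p = entry W' (ctx_at p) p s t.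

Let n_le_N : n < N. Proof. by rewrite /N addn1 ltnS leq_addr. Qed.
Let N0 : 0 < N. Proof. exact: leq_ltn_trans n_le_N. Qed.
Let N1 : 1 < N. Proof. by apply: leq_ltn_trans n_le_N; apply: leq_ltn_trans ltsn. Qed.
Let RE : R = M * N. Proof. by rewrite /R expnS mulnC. Qed.

(** The layers occupy the cells below [R] and the answer those from [R] to at most [R + N]. Since
    [N >= 2], one more power of [N] has room for both, which explains [K = W + 2]. *)
Let R_lt : R + N < N ^ K.
Proof.
have NR : N < R by rewrite /R -{1}(expn1 N) ltn_exp2l.
have : 2 * R <= N ^ K by rewrite /K expnS -/R leq_mul2r N1 orbT.
by move: NR; move: (N ^ K); clear; lia.
Qed.

Let layer_lt i w : i < N -> w < M -> M * i + w < R.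
Proof. rewrite RE; nia. Qed.

(* [0] if [t] is not reachable from the window [w] in exactly [i] steps,
   otherwise one plus the least total charge. *)
Definition dist_table i w := T (M * i + w).
Definition cand i w x :=
  if adj E (w %% N) x then
    if dist_table i (shift W' N w x) == 0 then 0
    else dist_table i (shift W' N w x) + (N * new_nbrs n E (digits N W w) x + 1)
  else 0.

(** Layer [i] ends before cell [M * i + M], so a cell [p] from there on sees its final values. *)
Let candidateE p i w x : i < N -> w < M -> x < N -> M * i + M <= p ->
  candidate W' (ctx_at p) x (M * i) w = cand i w x.
Proof.
move=> iN wM xN ip; rewrite /candidate adj_codeE // residueE ?ltn_expK // expn1.
rewrite /cand; case axw: (adj E _ x) => //.
have shl := shift_lt N0 wM xN.
have -> : table (ctx_at p) (M * i + shift W' (dim (ctx_at p)) w x) = dist_table i (shift W' N w x).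
  rewrite /= /below /dist_table; case: ltnP => // h.
  by move: (leq_trans ip h); rewrite leq_add2l leqNgt shl.
by rewrite freshE ?(adj_lt wf axw).2 // scaleE expn1.
Qed.

Lemma dist_table0 w : w < M -> dist_table 0 w = (w %% N == t).
Proof.
move=> wM; have wR := layer_lt N0 wM.
rewrite /dist_table HT; last by apply: ltn_trans wR _; apply: leq_ltn_trans R_lt; apply: leq_addr.
rewrite /entry /base scaleE muln1 -/R wR /layer_entry scaleE muln1 muln0 add0n -/M wM.
by rewrite residueE ?ltn_expK // expn1.
Qed.

Lemma dist_tableS i w : i.+1 < N -> w < M ->
  dist_table i.+1 w = bmin N (fun x => cand i w x).
Proof.
move=> iN wM; have wR := layer_lt iN wM.
have wK : M * i.+1 + w < N ^ K.
  by apply: ltn_trans wR _; apply: leq_ltn_trans R_lt; apply: leq_addr.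
rewrite /dist_table HT //.
rewrite /entry /base scaleE muln1 -/R wR /layer_entry scaleE muln1 -/M.
have -> : residue W' N W'.+1 (M * i.+1 + w) = w.
  by rewrite residueE // mulnC modnMDl modn_small.
have -> : (M * i.+1 + w < M) = false by rewrite mulnS ltnNge -addnA leq_addr.
have -> : M * i.+1 + w - M - w = M * i by rewrite mulnS; clear; lia.
apply: bmin_ext => x xN; apply: candidateE => //; first exact: ltnW.
by rewrite mulnS addnC leq_addr.
Qed.

(** Together with [best_walkP], where the value is attained, this makes each table value an exact
    minimum. *)
Lemma dist_table_le i w q : i < N -> w < M -> path (adj E) (w %% N) q ->
  last (w %% N) q = t -> size q = i ->
  0 < dist_table i w <= 1 + N * weight n E W (digits N W w) q + i.
Proof.
elim: i w q => [|i IH] w [|x q] iN wM //.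
  by move=> _ /= wt _; rewrite dist_table0 // wt eqxx muln0.
rewrite weight_cons => /andP[ax pq] lq [sq]; rewrite dist_tableS //.
have xn := (adj_lt wf ax).2; have xN := ltn_trans xn n_le_N.
have shl := shift_lt N0 wM xN.
have := IH (shift W' N w x) q (ltnW iN) shl.
rewrite shift_mod // => /(_ pq lq sq) /andP[g0 gle].
have cx : cand i w x = dist_table i (shift W' N w x) +
    (N * new_nbrs n E (digits N W w) x + 1).
  by rewrite /cand ax; case: eqP g0 => // ->.
case: (bminP N (fun x => cand i w x)) => [[_ /(_ x xN)]|[b0 [_ bmin_le]]].
  by rewrite cx; move: g0; clear; lia.
rewrite b0 andTb; apply: leq_trans (bmin_le x xN _) _; first by rewrite cx; move: g0; clear; lia.
rewrite cx [take _ _]take_oversize ?size_digits //.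
move: gle; rewrite digits_shift // (@weight_take _ _ _ _ (x :: digits N W w)); last first.
  by rewrite -take_min minnn.
by rewrite mulnDr -/W => gle; apply: leq_trans (leq_add gle (leqnn _)) _; clear; lia.
Qed.

Definition next i w := blast N (fun x => cand i w x == dist_table i.+1 w).
Fixpoint best_walk i w :=
  if i is i'.+1 then next i' w :: best_walk i' (shift W' N w (next i' w)) else [::].

Lemma nextP i w : i.+1 < N -> w < M -> 0 < dist_table i.+1 w ->
  [/\ next i w < N, adj E (w %% N) (next i w),
      0 < dist_table i (shift W' N w (next i w)) &
      dist_table i.+1 w = dist_table i (shift W' N w (next i w)) +
        (N * new_nbrs n E (digits N W w) (next i w) + 1)].
Proof.
move=> iN wM g0.
have [|lt /eqP] := @blastP N (fun x => cand i w x == dist_table i.+1 w).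
  move: g0; rewrite dist_tableS //.
  case: (bminP N (fun x => cand i w x)) => [[-> //]|[_ [[x xN <-] _]] _].
  by exists x.
rewrite -/(next i w) in lt *; move: g0; rewrite -/(next i w) /cand => g0.
case: ifP => [ax|_ h]; last by rewrite -h in g0.
by case: posnP => [_ h|p h]; [rewrite -h in g0 | split].
Qed.

Lemma best_walkP i w : i < N -> w < M -> 0 < dist_table i w ->
  [/\ path (adj E) (w %% N) (best_walk i w), last (w %% N) (best_walk i w) = t,
      size (best_walk i w) = i &
      dist_table i w = 1 + N * weight n E W (digits N W w) (best_walk i w) + i].
Proof.
elim: i w => [|i IH] w iN wM.
  rewrite dist_table0 //; case: eqP => // wt _; split=> //.
  by rewrite muln0.
rewrite [best_walk _ _]/= weight_cons => g0; have [xN ax g1 gE] := nextP iN wM g0.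
have shl := shift_lt N0 wM xN.
have := IH _ (ltnW iN) shl g1; rewrite shift_mod // => -[pq lq sq gq].
split; [by rewrite /= ax | by [] | by rewrite /= sq |].
rewrite gE gq digits_shift // (@weight_take _ _ _ _ (next i w :: digits N W w)); last first.
  by rewrite -take_min minnn.
rewrite [take _ (digits _ _ _)]take_oversize ?size_digits // mulnDr -/W; clear; lia.
Qed.
Let w0 := pad W N s.

Let w0P : w0 < M /\ digits N W w0 = nseq W s.
Proof. exact: padP (ltn_trans ltsn n_le_N). Qed.

Let w0_mod : w0 %% N = s.
Proof. by case: w0P => _ /(congr1 (head 0)). Qed.

Let key := bmin N (fun i => dist_table i w0).

Let below_dist p i : R <= p -> i < N -> below T p (M * i + w0) = dist_table i w0.
Proof.
move=> Rp iN; rewrite /below; have := leq_trans (layer_lt iN w0P.1) Rp.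
by move=> ->.
Qed.

Let entry_high p : R <= p -> (p < base W' N) = false.
Proof. by rewrite /base scaleE muln1 ltnNge => ->. Qed.

Let baseE : base W' N = R. Proof. by rewrite /base scaleE muln1. Qed.

Lemma table_length : T R =
  if key == 0 then 0 else blast N (fun i => dist_table i w0 == key) + 1.
Proof.
rewrite HT; last by apply: leq_ltn_trans R_lt; apply: leq_addr.
rewrite /entry entry_high // baseE eqxx /opt_len.
have -> : opt_key W' (ctx_at R) s = key.
  by apply: bmin_ext => i iN; rewrite scaleE; exact: below_dist.
case: eqP => // _; congr (_ + _); apply: blast_ext => i iN.
by rewrite scaleE; congr (_ == _); exact: below_dist.
Qed.

Lemma table_first_window : T (R + 1) = w0.
Proof.
rewrite HT; last by apply: leq_ltn_trans R_lt; rewrite leq_add2l.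
rewrite /entry entry_high ?leq_addr // baseE eqxx.
by have -> : (R + 1 == R) = false by clear; lia.
Qed.

Lemma table_next_window l : l.+1 < N -> T R <= N -> T (R + 1 + l) < M ->
  T (R + 1 + l.+1) =
  shift W' N (T (R + 1 + l)) (next (T R - 2 - l) (T (R + 1 + l))).
Proof.
move=> lN TRN wM; set w := T (R + 1 + l) in wM *; set i := T R - 2 - l.
have pK : R + 1 + l.+1 < N ^ K by apply: leq_trans R_lt; move: lN; clear; lia.
have iN : i.+1 < N by move: TRN N1; rewrite /i; clear; lia.
rewrite HT // /entry entry_high; last by clear; lia.
rewrite baseE; have -> : (R + 1 + l.+1 == R) = false by clear; lia.
have -> : (R + 1 + l.+1 == R + 1) = false by clear; lia.
rewrite /window_entry baseE.
have -> : table (ctx_at (R + 1 + l.+1)) (R + 1 + l.+1 - 1) = w.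
  rewrite /= /below /w; have -> : R + 1 + l.+1 - 1 = R + 1 + l by clear; lia.
  by have -> : R + 1 + l < R + 1 + l.+1 by clear; lia.
have -> : table (ctx_at (R + 1 + l.+1)) R = T R.
  by rewrite /= /below; have -> : R < R + 1 + l.+1 by clear; lia.
have -> : R + 1 + l.+1 - (R + 2) = l by clear; lia.
congr shift; rewrite -/i; apply: blast_ext => x xN.
have iM : M * i + M <= R.
  by rewrite RE -{2}(muln1 M) -mulnDr leq_mul2l addn1 (ltnW iN) orbT.
rewrite scaleE candidateE //; first last.
- by apply: leq_trans iM _; clear; lia.
- exact: ltnW.
congr (_ == _); rewrite scaleE muln1 -/M.
have -> : M * i + M + w = M * i.+1 + w by rewrite mulnS [M + _]addnC.
have hR : R <= R + 1 + l.+1 by clear; lia.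
by rewrite /= /below (leq_trans (layer_lt iN wM) hR).
Qed.

(** Induction on the number [i] of steps left; the window index [l] rises as [i] falls, so
    [l + i + 1] remains the number of vertices. *)
Lemma table_walk i l : T R = l + i + 1 -> T R <= N ->
  T (R + 1 + l) < M -> 0 < dist_table i (T (R + 1 + l)) ->
  [seq T (R + 1 + j) %% N | j <- iota l i.+1] =
    T (R + 1 + l) %% N :: best_walk i (T (R + 1 + l)) /\
  forall j, l <= j <= l + i -> T (R + 1 + j) < M.
Proof.
elim: i l => [|i IH] l TR TRN wM g0.
  split=> // j; rewrite addn0 => h; suff -> : j = l by [].
  by move: h; clear; lia.
have iN : i.+1 < N by move: TR TRN; clear; lia.
have [xN ax g1 _] := nextP iN wM g0.
have lN : l.+1 < N by move: TR TRN; clear; lia.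
have := table_next_window lN TRN wM.
have -> : T R - 2 - l = i by rewrite TR; clear; lia.
move=> En; have [|||Em Eb] := IH l.+1 _ TRN; rewrite ?En //.
- by rewrite TR; clear; lia.
- exact: shift_lt.
split.
  rewrite [best_walk _ _]/= -[LHS]/(_ :: [seq T (R + 1 + j) %% N | j <- iota l.+1 i.+1]).
  by rewrite Em En shift_mod.
move=> j /andP[lj ji]; case: (ltngtP l j) lj => // [lj _|<- _ //].
by apply: Eb; rewrite lj addSnnS.
Qed.

Theorem table_correct :
  (T R = 0 /\ forall P, ~~ walk E s t P) \/
  exists q, [/\ walk E s t (s :: q),
    forall Q, walk E s t Q -> potential n E N (s :: q) <= potential n E N Q,
    T R = (size q).+1,
    [seq T (R + 1 + j) %% N | j <- iota 0 (size q).+1] = s :: q &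
    size q < N /\ forall j, j <= size q -> T (R + 1 + j) < M].
Proof.
have [w0M w0D] := w0P.
case: (bminP N (fun i => dist_table i w0)); rewrite -/key => -[k0].
  move=> none; left; rewrite table_length k0 eqxx; split=> // P; apply/negP => wP.
  (* A simple walk has at most [n] vertices, hence fewer than [N] steps, and would give some layer a
     positive value. *)
  have [Q wQ [uQ _ _]] := walk_simple wP.
  have Qn := walk_lt wf ltsn wQ.
  have sQ : size Q <= n.
    rewrite -(size_iota 0 n); apply: uniq_leq_size => // z zQ.
    by rewrite mem_iota (allP Qn).
  case: Q wQ uQ Qn sQ => // x q /and3P[/eqP -> pq /eqP lq] _ _ sq.
  have qN : size q < N by apply: ltn_trans n_le_N.
  have := @dist_table_le (size q) w0 q qN w0M; rewrite w0_mod none //.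
  by move=> /(_ pq lq erefl).
move=> [[i iN gi] key_le]; right.
set m := blast N (fun i => dist_table i w0 == key).
have [mN /eqP gm] : m < N /\ dist_table m w0 == key.
  by apply: (@blastP N (fun i => dist_table i w0 == key)); exists i => //; apply/eqP.
have TR : T R = 0 + m + 1.
  by rewrite table_length; case: eqP k0 => [->|].
have g0 : 0 < dist_table m w0 by rewrite gm.
have := @table_walk m 0 TR; rewrite addn0 table_first_window => H.
have [|Ew Eb] := H _ w0M g0; first by rewrite TR addn1.
have [pq lq sq gq] := best_walkP mN w0M g0; move: pq lq gq.
rewrite w0_mod w0D in Ew *; move: sq Ew; set q := best_walk m w0 => sq Ew pq lq gq.
have wq : walk E s t (s :: q) by rewrite /= eqxx pq lq eqxx.
exists q; split; rewrite ?sq //; last first.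
- by rewrite TR addn1.
(* It is enough to compare with a walk [P] of least potential. It is simple, so its length is within
   the layers, and its local charge is exact. The potential of [s :: q] is at most its charged
   value, which is at most the charged value of [P] by choice of [key], and the latter is the
   potential of [P]. *)
have [P wP minP] := @exists_minimal _ (walk E s t) (potential n E N) _ wq.
move=> Q wQ; apply: leq_trans (minP Q wQ).
have Pn := walk_lt wf ltsn wP.
have uP := minimal_uniq wP minP.
case: P wP minP Pn uP => // x p wP minP Pn uP.
have xs : x = s by case/and3P: wP => /eqP.
subst x.
have sp : size p < N.
  apply: ltn_trans n_le_N; rewrite -[_.+1]/(size (s :: p)) -(size_iota 0 n).
  by apply: uniq_leq_size => // z zP; rewrite mem_iota (allP Pn).
have [pp lp] : path (adj E) s p /\ last s p = t by case/and3P: wP => _ -> /eqP.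
have := @dist_table_le (size p) w0 p sp w0M.
rewrite w0_mod w0D => /(_ pp lp erefl) /andP[gp0 gp].
have key_p := key_le _ sp gp0.
have costP := @minimal_weight n D E s t N wf ltsn degD N0 (s :: p) wP minP W p erefl (ltnSn _).
have costq : cost n E (s :: q) <= cost n E [:: s] + weight n E W (nseq W s) q.
  apply: leq_trans (leq_trans (cost_le_weight n E W (nseq W s) q) _).
    apply: cost_sub => z; rewrite catrevE mem_cat mem_rev mem_nseq inE orbC.
    by rewrite andTb.
  rewrite leq_add2r; apply: cost_sub => z; rewrite mem_nseq inE.
  by rewrite andTb.
move: gm gq key_p gp; rewrite /potential costP => -> -> key_p gp.
have := leq_trans key_p gp; rewrite [size (s :: q)]/= [size (s :: p)]/= sq => le.
apply: leq_trans (leq_add (leq_mul (leqnn N) costq) (leqnn _)) _.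
by rewrite !mulnDr; move: le; clear; lia.
Qed.
End Correctness.

Lemma is_st_path_walk E s t P : is_st_path E s t P = walk E s t P && uniq P.
Proof. by case: P => //= x q; rewrite -!andbA. Qed.

(* For every constant D, Secluded Path restricted to unweighted undirected
   graphs of maximum degree <= D is solvable in polynomial time. *)
Theorem theorem4 : forall D : nat, exists p : program, solves_secluded_path_poly D p.
Proof.
(* The argument is the window length minus one: windows hold [D + 4] vertices. *)
move=> D; have [p [a [k H]]] := algorithm_program (D + 3).
exists p, a, k => n s t E wf sn tn deg fin.
have n0 : 0 < n by apply: leq_ltn_trans sn.
have [hf [T [HT]]] := H n s t E n0; rewrite -/fin => Hout; split=> //.
pose N := n + size E + 1; pose R := N ^ (D + 3).+2.
have baseE : base (D + 3) N = R by rewrite /base scaleE muln1.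
have N0 : 0 < N by rewrite /N addn1.
have m0 : Defs.mem fin 0 = T R by rewrite Hout ?addn4 // /out eqxx baseE.
case: (table_correct wf sn deg HT) => [[TR none]|[q [wq minq TR Eq [qN Tlt]]]].
  have -> : output (Defs.mem fin) = [::] by rewrite /output m0 TR.
  split=> //; split=> // _ [P]; rewrite is_st_path_walk => /andP[wP _].
  by have := none P; rewrite wP.
have -> : output (Defs.mem fin) = s :: q.
  rewrite /output m0 TR -[RHS]Eq; apply/eq_in_map => i.
  rewrite mem_iota add0n => /andP[_ iq].
  rewrite Hout; last by move: iq qN; rewrite -/N; clear; lia.
  rewrite /out baseE; have -> : R + i.+1 = R + 1 + i by clear; lia.
  have lt : T (R + 1 + i) < N ^ (D + 3).+3 by apply: ltn_expK N0 _ (Tlt i iq).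
  by rewrite (residueE N0 1 lt) expn1.
have uq : uniq (s :: q) by apply: minimal_uniq wq minq.
split; first by split=> // nop; case: nop; exists (s :: q); rewrite is_st_path_walk wq.
move=> _; split=> [|Q]; rewrite is_st_path_walk ?wq // => /andP[wQ uQ].
have Qn := walk_lt wf sn wQ.
have sQ : size Q <= n.
  rewrite -(size_iota 0 n); apply: uniq_leq_size => // z zQ.
  by rewrite mem_iota (allP Qn).
have nN : n < N by rewrite /N addn1 ltnS leq_addr.
(* A cheaper [Q] would save at least [N] in the term [N * cost], which its length [size Q <= n < N]
   cannot offset. Hence least potential implies least cost among paths. *)
have le := minq Q wQ; rewrite leqNgt; apply/negP => lt.
have := leq_mul (leqnn N) lt; rewrite mulnS; move: le sQ nN; rewrite /potential /=.
by move: (N * _) (N * _) (size Q); clear; lia.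
Qed.
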